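(* Let $M\colon\mathbb{R}_+\to(0,\infty)$ be a regularly growing function, and let $\beta>0$ be as in condition (iii) of the definition of regular growth. Then there exist a complex Banach space $X$ and a bounded $C_0$-semigroup $(T(t))_{t\ge0}$ on $X$ whose generator $A$ satisfies $\sigma(A)\cap i\mathbb{R}=\emptyset$, $\|R(is,A)\|=O(M(|s|))$ as $|s|\to\infty$ and $$\limsup_{t\to\infty}\big\|M_{\mathrm{log}}^{-1}(ct)\,T(t)A^{-1}\big\|>0,$$ where $c=1+\beta^{-1}$ and $M_{\mathrm{log}}(s)=M(s)\big(\log(1+s)+\log(1+M(s))\big)$, $s\ge0$.
   Context: $\mathbb{R}_+=[0,\infty)$. A function $M\colon\mathbb{R}_+\to(0,\infty)$ is called regularly growing if: (i) $M$ is non-decreasing and continuous; (ii) there exists $\kappa\in(0,1)$ such that $M(s)\ge \kappa M\big(s+\frac{\kappa}{M(s)}\big)$ for all $s\ge0$; (iii) there exist constants $C,\alpha,\beta>0$ such that $C^{-1}s^\beta\le M(s)\le Ce^{\alpha s}$ for all sufficiently large $s\ge0$. $M_{\mathrm{log}}^{-1}$ denotes the inverse function of the continuous strictly increasing function $M_{\mathrm{log}}$, defined for all sufficiently large arguments; $M_{\mathrm{log}}^{-1}(ct)$ is a scalar multiplying the bounded operator $T(t)A^{-1}$. $\sigma(A)$ is the spectrum of $A$ and $R(\lambda,A)=(\lambda-A)^{-1}$ its resolvent. A $C_0$-semigroup is bounded if $\sup_{t\ge0}\|T(t)\|<\infty$. *)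

(* Defs.v *)
From Stdlib Require Import Reals.
From Coquelicot Require Import Coquelicot.

Open Scope R_scope.

(* Functions on [0, oo) are represented by total functions on R of which only
   the values at nonnegative arguments are ever used. *)

Definition growth_bounds (M : R -> R) (beta : R) : Prop :=
  exists C alpha : R, 0 < C /\ 0 < alpha /\
    Rbar_locally p_infty (fun s =>
      / C * Rpower s beta <= M s /\ M s <= C * exp (alpha * s)).

Record regularly_growing (M : R -> R) : Prop := {
  rg_pos : forall s, 0 <= s -> 0 < M s;
  rg_nondecreasing : forall s t, 0 <= s -> s <= t -> M s <= M t;
  rg_continuous : continuous_on (fun s => 0 <= s) M;
  rg_slow : exists kappa, 0 < kappa < 1 /\
    forall s, 0 <= s -> kappa * M (s + kappa / M s) <= M s;
  rg_bounds : exists beta, 0 < beta /\ growth_bounds M beta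
}.

Definition M_log (M : R -> R) (s : R) : R :=
  M s * (ln (1 + s) + ln (1 + M s)).

(* The unique s >= 0 with M_log M s = t; meaningful for t >= M_log M 0. *)
Definition M_log_inv (M : R -> R) (t : R) : R :=
  iota (fun s : R => 0 <= s /\ M_log M s = t).

(* limsup as t -> +oo, i.e. inf over t0 of sup over t >= t0. *)
Definition limsup_p_infty (f : R -> Rbar) : Rbar :=
  Rbar_glb (fun u => exists t0 : R,
    u = Rbar_lub (fun v => exists t : R, t0 <= t /\ v = f t)).

Section Operators.

Context {X : CompleteNormedModule C_AbsRing}.

(* Extended-real valued: p_infty for an unbounded operator. *)
Definition op_norm (L : X -> X) : Rbar :=
  Lub_Rbar (fun r => exists x : X, norm x <= 1 /\ r = norm (L x)).

(* A possibly unbounded operator A with domain D(A) is represented by its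
   graph: [A x y] means "x in D(A) and A x = y". *)
(* Graph of lambda - A, with domain D(A). *)
Definition op_shift (lambda : C) (A : X -> X -> Prop) (x y : X) : Prop :=
  exists z, A x z /\ y = minus (scal lambda x) z.

Definition op_bijective (A : X -> X -> Prop) : Prop :=
  forall y, exists! x, A x y.

(* The inverse of A; meaningful when A is bijective from D(A) onto X. *)
Definition op_inv (A : X -> X -> Prop) (y : X) : X := iota (fun x => A x y).

Definition resolvent (lambda : C) (A : X -> X -> Prop) : X -> X :=
  op_inv (op_shift lambda A).

(* [is_linear] is Coquelicot's notion of a bounded linear map. *)
Definition resolvent_set (A : X -> X -> Prop) (lambda : C) : Prop :=
  op_bijective (op_shift lambda A) /\ is_linear (resolvent lambda A).

Definition spectrum (A : X -> X -> Prop) (lambda : C) : Prop :=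
  ~ resolvent_set A lambda.

(* T : R -> X -> X is only considered at times t >= 0. *)
Record C0_semigroup (T : R -> X -> X) : Prop := {
  sg_bounded_linear : forall t, 0 <= t -> is_linear (T t);
  sg_zero : forall x, T 0 x = x;
  sg_plus : forall s t x, 0 <= s -> 0 <= t -> T (s + t) x = T s (T t x);
  sg_continuous : forall x, filterlim (fun t => T t x) (at_right 0) (locally x)
}.

Definition bounded_semigroup (T : R -> X -> X) : Prop :=
  exists K : R, forall t, 0 <= t -> Rbar_le (op_norm (T t)) (Finite K).

(* Graph of the generator: A x = lim_{h -> 0+} (T(h) x - x) / h, with D(A) the
   set of x for which this limit exists. *)
Definition generator (T : R -> X -> X) (x y : X) : Prop :=
  filterlim (fun h : R => scal (RtoC (/ h)) (minus (T h x) x))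
    (at_right 0) (locally y).

End Operators.

(* Main.v *)
Require Import Defs.
From Stdlib Require Import Reals.
From Stdlib Require Import Lra Lia Arith.
From Stdlib Require Import FunctionalExtensionality PropExtensionality
  ProofIrrelevance ClassicalEpsilon IndefiniteDescription.
From Coquelicot Require Import Coquelicot.

Open Scope R_scope.

(** The space is a c_0-sum of finite-dimensional blocks, one for each term of a
    sequence of frequencies [r n] tending to infinity. On the [n]-th block the
    generator is [i r - 1 + S], where [r = r n] and [S] is the left shift on rows
    [v 0, ..., v D]. Hence [T(t)] is, up to a factor of modulus 1, the
    average of the powers [S^j] with Poisson weights [e^-t t^j / j!].

    The norm of a block, [sup_j |v j| + (1/P) sum_j (1 + 1/P)^j |v j|], is modelled
    on the translation semigroup on the intersection of a sup-normed space and a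
    weighted [L^1], for which decay in operator norm is slower than the resolvent
    suggests.
    - [S] is a contraction, so the semigroup is contractive.
    - The weighted sum contracts under [S] by the factor [1 / (1 + 1/P)], and it
      dominates the sup-norm of [sum_j c_j S^j v] whenever [|c_j| <= 1]. The
      resolvent on the imaginary axis therefore has norm [O(P)]
      ([block_resolvent_bound]).
    - At a point [i s] with [|s - r| >= 1] the resolvent is the Neumann series of
      [S / (1 + i (s - r))], which sums to at most 3 because [S] is a contraction
      ([block_resolvent_bound_far]).
    - A row equal to 1 on an interval of length about [4 sqrt t] around [t] has
      norm [O(1)] as long as [t] is at most [P log P / 12] ([test_row_norm]). By
      Chebyshev's inequality this interval carries most of the Poisson weights of
      parameter [t], so that at time [t] the orbit is at least 1/2 at the
      coordinate 0 ([test_row_orbit]). So the block does not decay before time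
      [P log P / 12], which is longer than [P] by the logarithm that turns [M]
      into [M_log].

    Take [P = 24 M(r)]. As [M] grows at most exponentially, there are arbitrarily
    large [r] with [M(r) <= C1 M(r - 1)] ([slow_growth_points]), and for these the
    resolvent of the block is [O(M(|s|))] both near and far from [r]. The lower
    bound on [M] gives [log r <= (log M(r)) / beta + O(1)], so that
    [M_log(r) <= 2 (1 + 1/beta) M(r) log M(r)] for large [r]: at the time
    [t = M_log(r) / (1 + 1/beta)] the block has not decayed
    ([frequencies_exist]). On it [A^-1] has norm at least [1 / (r + 2)], and
    [r = M_log^-1 ((1 + 1/beta) t)], so [M_log^-1 ((1 + 1/beta) t) T(t) A^-1] has
    norm bounded below along this sequence of times. *)

(** * Finite sums *)

(* Sums have the carrier of an abstract monoid as their type, which [ring] does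
   not recognise. *)
Ltac ring_C := match goal with |- @eq _ ?a ?b => change (@eq C a b); ring end.
Ltac ring_R := match goal with |- @eq _ ?a ?b => change (@eq R a b); ring end.

Lemma sum_n_S_l (G : AbelianMonoid) (a : nat -> G) (n : nat) :
  sum_n a (S n) = plus (a 0%nat) (sum_n (fun j => a (S j)) n).
Proof.
unfold sum_n. rewrite sum_Sn_m by lia. now rewrite sum_n_m_S.
Qed.

Lemma sum_n_zero (G : AbelianMonoid) (a : nat -> G) (n : nat) :
  (forall j, (j <= n)%nat -> a j = zero) -> sum_n a n = zero.
Proof.
intros H. rewrite (sum_n_ext_loc a (fun _ => zero)) by exact H.
apply sum_n_m_const_zero.
Qed.

Lemma sum_n_truncate (G : AbelianMonoid) (a : nat -> G) (m n : nat) :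
  (m <= n)%nat -> (forall j, (m < j)%nat -> a j = zero) -> sum_n a n = sum_n a m.
Proof.
intros H Ha. induction H as [|n H IH]; [easy|].
now rewrite sum_Sn, IH, Ha, plus_zero_r by lia.
Qed.

Lemma sum_n_rev (G : AbelianMonoid) (a : nat -> G) (n : nat) :
  sum_n (fun i => a (n - i)%nat) n = sum_n a n.
Proof.
induction n as [|n IH]; [now rewrite !sum_O|].
rewrite sum_n_S_l, sum_Sn, Nat.sub_0_r, plus_comm. f_equal. exact IH.
Qed.

Lemma sum_n_triangle (G : AbelianMonoid) (g : nat -> nat -> G) (n : nat) :
  sum_n (fun l => sum_n (fun i => g i (l - i)%nat) l) n
  = sum_n (fun i => sum_n (g i) (n - i)) n.
Proof.
induction n as [|n IH]; [now rewrite !sum_O|].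
rewrite sum_Sn, IH, (sum_Sn (fun i => sum_n (g i) (S n - i))), sum_Sn.
rewrite (sum_n_ext_loc (fun i => sum_n (g i) (S n - i))
  (fun i => plus (sum_n (g i) (n - i)) (g i (S n - i)%nat))).
- rewrite sum_n_plus, plus_assoc. f_equal. now rewrite Nat.sub_diag, sum_O.
- intros i Hi. replace (S n - i)%nat with (S (n - i)) by lia. apply sum_Sn.
Qed.

Lemma sum_n_le (a b : nat -> R) (n : nat) :
  (forall j, (j <= n)%nat -> a j <= b j) -> sum_n a n <= sum_n b n.
Proof.
induction n as [|n IH]; intros H.
- rewrite !sum_O. now apply H.
- rewrite !sum_Sn. apply Rplus_le_compat; [apply IH; intros; apply H|apply H]; lia.
Qed.

Lemma sum_n_ge0 (a : nat -> R) (n : nat) :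
  (forall j, (j <= n)%nat -> 0 <= a j) -> 0 <= sum_n a n.
Proof.
intros H. rewrite <- (sum_n_zero R_AbelianMonoid (fun _ => 0) n : _ -> _ = 0).
- now apply sum_n_le.
- easy.
Qed.

Lemma sum_n_translate_le (g : nat -> R) (j n : nat) :
  (forall k, 0 <= g k) -> (forall k, (n < k)%nat -> g k = 0) ->
  sum_n (fun k => g (k + j)%nat) n <= sum_n g n.
Proof.
intros Hg Hz. induction j as [|j IH].
- right. apply sum_n_ext. intros k. f_equal. lia.
- apply Rle_trans with (2 := IH).
  set (h := fun k => g (k + j)%nat).
  rewrite (sum_n_ext _ (fun k => h (S k))) by (intros k; unfold h; f_equal; lia).
  assert (E := sum_n_S_l _ h n). rewrite sum_Sn in E.
  change (sum_n h n + h (S n) = h 0%nat + sum_n (fun k => h (S k)) n) in E.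
  assert (h (S n) = 0) by (apply Hz; lia).
  assert (0 <= h 0%nat) by apply Hg.
  change (sum_n (fun k => h (S k)) n <= sum_n h n). lra.
Qed.

Lemma sum_n_Rmult_l (a : R) (u : nat -> R) (n : nat) :
  sum_n (fun j => a * u j) n = a * sum_n u n.
Proof. apply (sum_n_mult_l (K := R_Ring) a u n). Qed.

Lemma sum_n_Rplus (a b : nat -> R) (n : nat) :
  sum_n (fun j => a j + b j) n = sum_n a n + sum_n b n.
Proof. apply (sum_n_plus (G := R_AbelianMonoid)). Qed.

Lemma sum_n_Cmult_l (a : C) (u : nat -> C) (n : nat) :
  sum_n (fun j => Cmult a (u j)) n = Cmult a (sum_n u n).
Proof. apply (sum_n_mult_l (K := C_Ring) a u n). Qed.

Lemma Cmod_sum_n (a : nat -> C) (n : nat) :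
  Cmod (sum_n a n) <= sum_n (fun j => Cmod (a j)) n.
Proof.
induction n as [|n IH]; [rewrite !sum_O; lra|].
rewrite !sum_Sn. eapply Rle_trans; [apply Cmod_triangle|].
apply Rplus_le_compat_r, IH.
Qed.

Lemma RtoC_sum_n (a : nat -> R) (n : nat) :
  RtoC (sum_n a n) = sum_n (fun j => RtoC (a j)) n.
Proof.
induction n as [|n IH]; [now rewrite !sum_O|].
rewrite !sum_Sn, <- IH. apply RtoC_plus.
Qed.

(** * Power series in the truncated shift *)

Definition supported (D : nat) (v : nat -> C) : Prop :=
  forall j, (D < j)%nat -> v j = 0.

(** The operator [sum_j c_j S^j], where [S] is the shift [(S v) k = v (k + 1)].
    It is nilpotent on rows supported in [0..D], hence the range of the sum. *)
Definition shift_series (D : nat) (c v : nat -> C) : nat -> C :=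
  fun k => sum_n (fun j => Cmult (c j) (v (k + j)%nat)) D.

Definition conv (c d : nat -> C) (l : nat) : C :=
  sum_n (fun i => Cmult (c i) (d (l - i)%nat)) l.

Definition delta0 (j : nat) : C := match j with O => 1 | S _ => 0 end.

Lemma shift_series_supported (D : nat) (c v : nat -> C) :
  supported D v -> supported D (shift_series D c v).
Proof.
intros Hv k Hk. apply (sum_n_zero C_AbelianMonoid). intros j _.
rewrite Hv by lia. apply Cmult_0_r.
Qed.

Lemma conv_comm (c d : nat -> C) (l : nat) : conv c d l = conv d c l.
Proof.
unfold conv. rewrite <- sum_n_rev. apply sum_n_ext_loc. intros i Hi.
replace (l - (l - i))%nat with i by lia. apply Cmult_comm.
Qed.

(** On rows supported in [0..D] composition of series is the Cauchy product:
    the terms [S^(i+j)] with [i + j > D] that the product lacks vanish. *)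
Lemma shift_series_comp (D : nat) (c d v : nat -> C) (k : nat) :
  supported D v ->
  shift_series D c (shift_series D d v) k = shift_series D (conv c d) v k.
Proof.
intros Hv.
set (g := fun i j : nat => Cmult (c i) (Cmult (d j) (v (k + i + j)%nat))).
transitivity (sum_n (fun i => sum_n (g i) (D - i)) D).
- apply sum_n_ext_loc. intros i Hi. unfold shift_series at 1.
  rewrite <- sum_n_Cmult_l. apply (sum_n_truncate C_AbelianMonoid); [lia|].
  intros j Hj. rewrite Hv by lia. change ((c i * (d j * 0))%C = 0). ring.
- rewrite <- sum_n_triangle. apply sum_n_ext_loc. intros l Hl. unfold conv.
  rewrite Cmult_comm, <- sum_n_Cmult_l. apply sum_n_ext_loc. intros i Hi.
  unfold g. replace (k + i + (l - i))%nat with (k + l)%nat by lia. ring_C.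
Qed.

Lemma shift_series_delta0 (D : nat) (v : nat -> C) (k : nat) :
  shift_series D delta0 v k = v k.
Proof.
unfold shift_series. rewrite (sum_n_truncate C_AbelianMonoid _ 0).
- rewrite sum_O, Nat.add_0_r. apply Cmult_1_l.
- lia.
- intros [|j] Hj; [lia|]. apply Cmult_0_l.
Qed.

Lemma shift_series_ext (D : nat) (c d v w : nat -> C) (k : nat) :
  (forall j, c j = d j) -> (forall j, v j = w j) ->
  shift_series D c v k = shift_series D d w k.
Proof.
intros Hc Hv. apply sum_n_ext. intros j. now rewrite Hc, Hv.
Qed.

Lemma shift_series_plus_r (D : nat) (c v w : nat -> C) (k : nat) :
  shift_series D c (fun j => Cplus (v j) (w j)) k
  = Cplus (shift_series D c v k) (shift_series D c w k).
Proof.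
unfold shift_series. change Cplus with (@plus C_AbelianMonoid) at 2.
rewrite <- sum_n_plus. apply sum_n_ext. intros j. apply Cmult_plus_distr_l.
Qed.

Lemma shift_series_scal_r (D : nat) (a : C) (c v : nat -> C) (k : nat) :
  shift_series D c (fun j => Cmult a (v j)) k = Cmult a (shift_series D c v k).
Proof.
unfold shift_series. rewrite <- sum_n_Cmult_l. apply sum_n_ext. intros j. ring_C.
Qed.

Lemma shift_series_plus_l (D : nat) (c d v : nat -> C) (k : nat) :
  shift_series D (fun j => Cplus (c j) (d j)) v k
  = Cplus (shift_series D c v k) (shift_series D d v k).
Proof.
unfold shift_series. change Cplus with (@plus C_AbelianMonoid) at 2.
rewrite <- sum_n_plus. apply sum_n_ext. intros j. apply Cmult_plus_distr_r.
Qed.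

Lemma shift_series_scal_l (D : nat) (a : C) (c v : nat -> C) (k : nat) :
  shift_series D (fun j => Cmult a (c j)) v k = Cmult a (shift_series D c v k).
Proof.
unfold shift_series. rewrite <- sum_n_Cmult_l. apply sum_n_ext. intros j. ring_C.
Qed.

(** * The norm of one block *)

Fixpoint max_abs (D : nat) (v : nat -> C) : R :=
  match D with
  | O => Cmod (v 0%nat)
  | S D' => Rmax (max_abs D' v) (Cmod (v D))
  end.

Definition weighted_sum (D : nat) (P : R) (v : nat -> C) : R :=
  sum_n (fun j => (1 + / P) ^ j * Cmod (v j)) D.

(** The intersection of a sup-normed space with a weighted [l^1]; the factor
    [/ P] makes [P] the order of magnitude of both parts of the resolvent. *)
Definition block_norm (D : nat) (P : R) (v : nat -> C) : R :=
  max_abs D v + / P * weighted_sum D P v.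

Lemma max_abs_ge (D j : nat) (v : nat -> C) :
  (j <= D)%nat -> Cmod (v j) <= max_abs D v.
Proof.
induction D as [|D IH]; intros Hj; simpl.
- replace j with 0%nat by lia. lra.
- destruct (Nat.eq_dec j (S D)) as [->|Hne]; [apply Rmax_r|].
  eapply Rle_trans; [apply IH; lia|apply Rmax_l].
Qed.

Lemma max_abs_le (D : nat) (v : nat -> C) (r : R) :
  (forall j, (j <= D)%nat -> Cmod (v j) <= r) -> max_abs D v <= r.
Proof.
induction D as [|D IH]; intros H; simpl; [now apply H|].
apply Rmax_lub; [apply IH; intros; apply H|apply H]; lia.
Qed.

Lemma max_abs_ge0 (D : nat) (v : nat -> C) : 0 <= max_abs D v.
Proof.
apply Rle_trans with (Cmod (v 0%nat)); [apply Cmod_ge_0|apply max_abs_ge; lia].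
Qed.

Lemma max_abs_shift_series (D : nat) (c v : nat -> C) :
  supported D v ->
  max_abs D (shift_series D c v)
  <= sum_n (fun j => Cmod (c j)) D * max_abs D v.
Proof.
intros Hv. apply max_abs_le. intros k _.
eapply Rle_trans; [apply Cmod_sum_n|].
rewrite Rmult_comm, <- sum_n_Rmult_l. apply sum_n_le. intros j _.
rewrite Cmod_mult, Rmult_comm.
apply Rmult_le_compat_r; [apply Cmod_ge_0|].
destruct (Nat.le_gt_cases (k + j) D) as [H|H]; [now apply max_abs_ge|].
rewrite Hv, Cmod_0 by easy. apply max_abs_ge0.
Qed.

Section BlockNorm.

Variables (D : nat) (P : R).
Hypothesis HP : 0 < P.

Let q_gt1 : 1 < 1 + / P.
Proof. assert (0 < / P) by now apply Rinv_0_lt_compat. lra. Qed.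

Lemma weight_gt0 (j : nat) : 0 < (1 + / P) ^ j.
Proof. apply pow_lt. lra. Qed.

Lemma weighted_sum_ge0 (v : nat -> C) : 0 <= weighted_sum D P v.
Proof.
apply sum_n_ge0. intros j _. apply Rmult_le_pos; [|apply Cmod_ge_0].
left. apply weight_gt0.
Qed.

Lemma weighted_sum_shift_series (c v : nat -> C) :
  supported D v ->
  weighted_sum D P (shift_series D c v)
  <= sum_n (fun j => Cmod (c j) * / (1 + / P) ^ j) D * weighted_sum D P v.
Proof.
intros Hv. set (q := 1 + / P).
apply Rle_trans with
  (sum_n (fun k => sum_n (fun j =>
     (Cmod (c j) * / q ^ j) * (q ^ (k + j) * Cmod (v (k + j)%nat))) D) D).
- apply sum_n_le. intros k _.
  eapply Rle_trans; [apply Rmult_le_compat_l, Cmod_sum_n; left; apply weight_gt0|].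
  right. rewrite <- sum_n_Rmult_l. apply sum_n_ext. intros j.
  assert (0 < q ^ j) by apply weight_gt0.
  fold q. rewrite Cmod_mult, pow_add.
  match goal with |- @eq _ ?a ?b => change (@eq R a b) end. field. lra.
- rewrite sum_n_switch, Rmult_comm, <- sum_n_Rmult_l. apply sum_n_le. intros j _.
  rewrite sum_n_Rmult_l, Rmult_comm. apply Rmult_le_compat_r.
  + apply Rmult_le_pos; [apply Cmod_ge_0|].
    left. apply Rinv_0_lt_compat, weight_gt0.
  + apply (sum_n_translate_le (fun k => q ^ k * Cmod (v k))).
    * intros k. apply Rmult_le_pos; [left; apply weight_gt0|apply Cmod_ge_0].
    * intros k Hk. rewrite Hv by easy. rewrite Cmod_0. ring.
Qed.

(** Bounding the sup-part of [sum_j c_j S^j v] by the weighted sum of [v]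
    costs only the factor [P] that the norm carries, however long the series. *)
Lemma max_abs_shift_series_weighted (c v : nat -> C) :
  supported D v -> (forall j, Cmod (c j) <= 1) ->
  max_abs D (shift_series D c v) <= weighted_sum D P v.
Proof.
intros Hv Hc. apply max_abs_le. intros k _.
eapply Rle_trans; [apply Cmod_sum_n|].
apply Rle_trans with (sum_n (fun j => Cmod (v (j + k)%nat)) D).
- apply sum_n_le. intros j _. rewrite Cmod_mult, (Nat.add_comm j k).
  rewrite <- (Rmult_1_l (Cmod (v (k + j)%nat))) at 2.
  apply Rmult_le_compat_r; [apply Cmod_ge_0|apply Hc].
- eapply Rle_trans; [apply (sum_n_translate_le (fun j => Cmod (v j)))|].
  + intros j. apply Cmod_ge_0.
  + intros j Hj. rewrite Hv by easy. apply Cmod_0.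
  + apply sum_n_le. intros j _. rewrite <- (Rmult_1_l (Cmod (v j))) at 1.
    apply Rmult_le_compat_r; [apply Cmod_ge_0|]. apply pow_R1_Rle. lra.
Qed.

Lemma block_norm_ge0 (v : nat -> C) : 0 <= block_norm D P v.
Proof.
apply Rplus_le_le_0_compat; [apply max_abs_ge0|].
apply Rmult_le_pos; [|apply weighted_sum_ge0]. left. now apply Rinv_0_lt_compat.
Qed.

Lemma block_norm_shift_series (c v : nat -> C) :
  supported D v ->
  block_norm D P (shift_series D c v)
  <= sum_n (fun j => Cmod (c j)) D * block_norm D P v.
Proof.
intros Hv. unfold block_norm. rewrite Rmult_plus_distr_l.
apply Rplus_le_compat; [now apply max_abs_shift_series|].
rewrite (Rmult_comm _ (/ P * _)), Rmult_assoc.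
apply Rmult_le_compat_l; [left; now apply Rinv_0_lt_compat|].
eapply Rle_trans; [now apply weighted_sum_shift_series|].
rewrite Rmult_comm. apply Rmult_le_compat_l; [apply weighted_sum_ge0|].
apply sum_n_le. intros j _. rewrite <- (Rmult_1_r (Cmod (c j))) at 2.
apply Rmult_le_compat_l; [apply Cmod_ge_0|].
rewrite <- Rinv_1. apply Rinv_le_contravar; [lra|]. apply pow_R1_Rle. lra.
Qed.

Lemma block_norm_coord (v : nat -> C) (j : nat) :
  (j <= D)%nat -> Cmod (v j) <= block_norm D P v.
Proof.
intros Hj. apply Rle_trans with (max_abs D v + 0).
- rewrite Rplus_0_r. now apply max_abs_ge.
- apply Rplus_le_compat_l, Rmult_le_pos; [|apply weighted_sum_ge0].
  left. now apply Rinv_0_lt_compat.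
Qed.

Lemma block_norm_triangle (u v w : nat -> C) :
  (forall j, w j = Cplus (u j) (v j)) ->
  block_norm D P w <= block_norm D P u + block_norm D P v.
Proof.
intros Hw. unfold block_norm.
assert (max_abs D w <= max_abs D u + max_abs D v).
{ apply max_abs_le. intros j Hj. rewrite Hw.
  eapply Rle_trans; [apply Cmod_triangle|].
  apply Rplus_le_compat; now apply max_abs_ge. }
assert (weighted_sum D P w <= weighted_sum D P u + weighted_sum D P v) as H0.
{ unfold weighted_sum. rewrite <- sum_n_Rplus. apply sum_n_le. intros j _.
  rewrite <- Rmult_plus_distr_l, Hw.
  apply Rmult_le_compat_l; [left; apply weight_gt0|apply Cmod_triangle]. }
assert (0 < / P) as HP' by now apply Rinv_0_lt_compat.
apply (Rmult_le_compat_l (/ P)) in H0; lra.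
Qed.

Lemma block_norm_scal (a : C) (v w : nat -> C) :
  (forall j, w j = Cmult a (v j)) ->
  block_norm D P w <= Cmod a * block_norm D P v.
Proof.
intros Hw. unfold block_norm. rewrite Rmult_plus_distr_l.
apply Rplus_le_compat.
- apply max_abs_le. intros j Hj. rewrite Hw, Cmod_mult.
  apply Rmult_le_compat_l; [apply Cmod_ge_0|now apply max_abs_ge].
- right. rewrite <- Rmult_assoc, (Rmult_comm (Cmod a)), Rmult_assoc. f_equal.
  unfold weighted_sum. rewrite <- sum_n_Rmult_l. apply sum_n_ext. intros j.
  rewrite Hw, Cmod_mult.
  ring_R.
Qed.

Lemma block_norm_le_sup (v : nat -> C) (e : R) :
  (forall j, (j <= D)%nat -> Cmod (v j) <= e) ->
  block_norm D P v <= e * (1 + / P * sum_n (fun j => (1 + / P) ^ j) D).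
Proof.
intros He. unfold block_norm. rewrite Rmult_plus_distr_l, Rmult_1_r.
apply Rplus_le_compat; [now apply max_abs_le|].
rewrite (Rmult_comm e), Rmult_assoc.
apply Rmult_le_compat_l; [left; now apply Rinv_0_lt_compat|].
rewrite Rmult_comm, <- sum_n_Rmult_l. apply sum_n_le. intros j Hj.
rewrite Rmult_comm. apply Rmult_le_compat_r; [left; apply weight_gt0|now apply He].
Qed.

Lemma block_norm_ext (v w : nat -> C) :
  (forall j, v j = w j) -> block_norm D P v = block_norm D P w.
Proof.
intros H. apply Rle_antisym.
- rewrite <- (Rmult_1_l (block_norm D P w)), <- Cmod_1. apply block_norm_scal.
  intros j. rewrite H. ring.
- rewrite <- (Rmult_1_l (block_norm D P v)), <- Cmod_1. apply block_norm_scal.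
  intros j. rewrite H. ring.
Qed.

End BlockNorm.

(** * The c_0-sum of the blocks *)

Section C0Sum.

Variables (D : nat -> nat) (P : nat -> R).
Hypothesis HP : forall n, 0 < P n.

Let N (n : nat) : (nat -> C) -> R := block_norm (D n) (P n).

Record c0_sum : Type := C0Sum {
  row :> nat -> nat -> C;
  row_supported : forall n, supported (D n) (row n);
  row_vanishing : forall eps, 0 < eps ->
    exists n0, forall n, (n0 <= n)%nat -> N n (row n) <= eps
}.

Lemma c0_sum_ext (f g : c0_sum) : (forall n j, f n j = g n j) -> f = g.
Proof.
destruct f as [f Hf Hf'], g as [g Hg Hg']. simpl. intros H.
assert (f = g) by (do 2 (apply functional_extensionality; intros ?); apply H).
subst g. f_equal; apply proof_irrelevance.
Qed.

Definition c0_plus (f g : c0_sum) : c0_sum.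
Proof.
refine (C0Sum (fun n j => Cplus (f n j) (g n j)) _ _).
- intros n j Hj. rewrite !row_supported by easy. apply Cplus_0_r.
- intros eps Heps.
  destruct (row_vanishing f (eps / 2)) as [n1 H1]; [lra|].
  destruct (row_vanishing g (eps / 2)) as [n2 H2]; [lra|].
  exists (Nat.max n1 n2). intros n Hn.
  specialize (H1 n ltac:(lia)). specialize (H2 n ltac:(lia)).
  eapply Rle_trans; [now apply block_norm_triangle with (u := f n) (v := g n)|].
  unfold N in *. lra.
Defined.

Lemma c0_bounded (f : c0_sum) : exists B, forall n, N n (f n) <= B.
Proof.
destruct (row_vanishing f 1) as [n0 H0]; [lra|].
assert (exists B, forall n, (n < n0)%nat -> N n (f n) <= B) as [B HB].
{ clear H0. induction n0 as [|m [B HB]]; [exists 0; lia|].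
  exists (Rmax B (N m (f m))). intros n Hn.
  destruct (Nat.eq_dec n m) as [->|Hne]; [apply Rmax_r|].
  eapply Rle_trans; [apply HB; lia|apply Rmax_l]. }
exists (Rmax B 1). intros n. destruct (Nat.lt_ge_cases n n0) as [H|H].
- eapply Rle_trans; [now apply HB|apply Rmax_l].
- eapply Rle_trans; [now apply H0|apply Rmax_r].
Qed.

Definition c0_scal (a : C) (f : c0_sum) : c0_sum.
Proof.
refine (C0Sum (fun n j => Cmult a (f n j)) _ _).
- intros n j Hj. rewrite row_supported by easy. apply Cmult_0_r.
- intros eps Heps.
  assert (Ha : 0 < Cmod a + 1) by (assert (H := Cmod_ge_0 a); lra).
  destruct (row_vanishing f (eps / (Cmod a + 1))) as [n0 H0].
  { now apply Rdiv_lt_0_compat. }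
  exists n0. intros n Hn. specialize (H0 n Hn).
  eapply Rle_trans; [now apply block_norm_scal with (a := a) (v := f n)|].
  apply Rle_trans with ((Cmod a + 1) * (eps / (Cmod a + 1))).
  + apply Rmult_le_compat; [apply Cmod_ge_0|apply block_norm_ge0, HP|lra|easy].
  + right. field. lra.
Defined.

Definition c0_zero : c0_sum.
Proof.
refine (C0Sum (fun _ _ => RtoC 0) _ _).
- easy.
- intros eps Heps. exists 0%nat. intros n _.
  eapply Rle_trans; [apply block_norm_scal with (a := RtoC 0) (v := fun _ => RtoC 0)|].
  + intros _. ring_C.
  + rewrite Cmod_0. lra.
Defined.

Definition c0_opp (f : c0_sum) : c0_sum := c0_scal (- (1)) f.

Definition c0_norm (f : c0_sum) : R :=
  real (Lub_Rbar (fun r => exists n, r = N n (f n))).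

Lemma c0_norm_lub (f : c0_sum) :
  is_lub_Rbar (fun r => exists n, r = N n (f n)) (c0_norm f).
Proof.
unfold c0_norm.
assert (H := Lub_Rbar_correct (fun r => exists n, r = N n (f n))).
destruct (Lub_Rbar _) as [r| |]; [exact H| |]; exfalso.
- destruct (c0_bounded f) as [B HB].
  apply (proj2 H (Finite B)). intros r [n ->]. apply HB.
- apply (proj1 H (N 0%nat (f 0%nat))). now exists 0%nat.
Qed.

Lemma row_norm_le (f : c0_sum) (n : nat) : N n (f n) <= c0_norm f.
Proof. apply (proj1 (c0_norm_lub f) (N n (f n))). now exists n. Qed.

Lemma c0_norm_le (f : c0_sum) (r : R) :
  (forall n, N n (f n) <= r) -> c0_norm f <= r.
Proof.
intros H. apply (proj2 (c0_norm_lub f) (Finite r)). intros x [n ->]. apply H.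
Qed.

Lemma coord_le (f : c0_sum) (n j : nat) : Cmod (f n j) <= c0_norm f.
Proof.
destruct (Nat.le_gt_cases j (D n)) as [H|H].
- eapply Rle_trans; [|apply row_norm_le]. now apply block_norm_coord.
- rewrite row_supported, Cmod_0 by easy.
  eapply Rle_trans; [|apply (row_norm_le f 0)]. apply block_norm_ge0, HP.
Qed.

Lemma c0_norm_triangle (f g : c0_sum) :
  c0_norm (c0_plus f g) <= c0_norm f + c0_norm g.
Proof.
apply c0_norm_le. intros n.
eapply Rle_trans; [now apply block_norm_triangle with (u := f n) (v := g n)|].
apply Rplus_le_compat; apply row_norm_le.
Qed.

Lemma c0_norm_scal (a : C) (f : c0_sum) :
  c0_norm (c0_scal a f) <= Cmod a * c0_norm f.
Proof.
apply c0_norm_le. intros n.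
eapply Rle_trans; [now apply block_norm_scal with (a := a) (v := f n)|].
apply Rmult_le_compat_l; [apply Cmod_ge_0|apply row_norm_le].
Qed.

Lemma c0_norm_eq0 (f : c0_sum) : c0_norm f = 0 -> f = c0_zero.
Proof.
intros H. apply c0_sum_ext. intros n j. apply Cmod_eq_0.
assert (H0 := coord_le f n j). assert (H1 := Cmod_ge_0 (f n j)). lra.
Qed.

Definition c0_AbelianMonoid_mixin : AbelianMonoid.mixin_of c0_sum.
Proof.
apply (AbelianMonoid.Mixin c0_sum c0_plus c0_zero); intros;
  apply c0_sum_ext; intros; simpl; ring_C.
Defined.

Definition c0_AbelianMonoid : AbelianMonoid :=
  AbelianMonoid.Pack c0_sum c0_AbelianMonoid_mixin c0_sum.

Definition c0_AbelianGroup_mixin : AbelianGroup.mixin_of c0_AbelianMonoid.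
Proof.
apply (AbelianGroup.Mixin c0_AbelianMonoid c0_opp). intros f.
apply c0_sum_ext; intros; simpl; ring_C.
Defined.

Definition c0_AbelianGroup : AbelianGroup :=
  AbelianGroup.Pack c0_sum
    (AbelianGroup.Class c0_sum c0_AbelianMonoid_mixin c0_AbelianGroup_mixin)
    c0_sum.

Definition c0_ModuleSpace_mixin : ModuleSpace.mixin_of C_Ring c0_AbelianGroup.
Proof.
apply (ModuleSpace.Mixin C_Ring c0_AbelianGroup c0_scal); intros;
  apply c0_sum_ext; intros; simpl.
- change ((x * (y * u n j))%C = ((x * y) * u n j)%C). ring.
- change ((1 * u n j)%C = u n j). ring.
- ring_C.
- change (((x + y) * u n j)%C = (x * u n j + y * u n j)%C). ring.
Defined.

Definition c0_ModuleSpace_class : ModuleSpace.class_of C_Ring c0_sum :=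
  ModuleSpace.Class C_Ring c0_sum
    (AbelianGroup.class c0_AbelianGroup) c0_ModuleSpace_mixin.

Lemma c0_norm_zero : c0_norm c0_zero = 0.
Proof.
apply Rle_antisym.
- replace c0_zero with (c0_scal (RtoC 0) c0_zero).
  + eapply Rle_trans; [apply c0_norm_scal|]. rewrite Cmod_0. lra.
  + apply c0_sum_ext. intros n j. simpl. ring_C.
- rewrite <- Cmod_0. apply (coord_le c0_zero 0 0).
Qed.

Definition c0_UniformSpace_mixin : UniformSpace.mixin_of c0_sum.
Proof.
apply (UniformSpace.Mixin c0_sum c0_zero
  (fun f eps g => c0_norm (c0_plus g (c0_opp f)) < eps)).
- intros f eps. replace (c0_plus f (c0_opp f)) with c0_zero.
  + rewrite c0_norm_zero. apply cond_pos.
  + apply c0_sum_ext. intros n j. simpl. ring_C.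
- intros f g eps. apply Rle_lt_trans.
  replace (c0_plus f (c0_opp g)) with (c0_opp (c0_plus g (c0_opp f))).
  + eapply Rle_trans; [apply c0_norm_scal|]. rewrite Cmod_m1. lra.
  + apply c0_sum_ext. intros n j. simpl. ring_C.
- intros f g h e1 e2 H1 H2.
  replace (c0_plus h (c0_opp f))
    with (c0_plus (c0_plus g (c0_opp f)) (c0_plus h (c0_opp g))).
  + eapply Rle_lt_trans; [apply c0_norm_triangle|]. lra.
  + apply c0_sum_ext. intros n j. simpl. ring_C.
Defined.

Definition c0_UniformSpace : UniformSpace :=
  UniformSpace.Pack c0_sum c0_UniformSpace_mixin c0_sum.

Definition c0_NormedModuleAux : NormedModuleAux C_AbsRing :=
  NormedModuleAux.Pack C_AbsRing c0_sum
    (NormedModuleAux.Class C_AbsRing c0_sum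
       c0_ModuleSpace_class c0_UniformSpace_mixin)
    c0_sum.

Definition c0_NormedModule_mixin :
  NormedModule.mixin_of C_AbsRing c0_NormedModuleAux.
Proof.
apply (NormedModule.Mixin C_AbsRing c0_NormedModuleAux c0_norm 1).
- exact c0_norm_triangle.
- exact c0_norm_scal.
- intros f g eps H. exact H.
- intros f g eps H. rewrite Rmult_1_l. exact H.
- exact c0_norm_eq0.
Defined.

Definition c0_NormedModule_class : NormedModule.class_of C_AbsRing c0_sum :=
  NormedModule.Class C_AbsRing c0_sum
    (NormedModuleAux.Class C_AbsRing c0_sum
       c0_ModuleSpace_class c0_UniformSpace_mixin)
    c0_NormedModule_mixin.

Lemma filter_forall_le (T : Type) (F : (T -> Prop) -> Prop) (HF : Filter F)
  (Q : nat -> T -> Prop) (n : nat) :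
  (forall j, F (Q j)) -> F (fun x => forall j, (j <= n)%nat -> Q j x).
Proof.
intros H. induction n as [|n IH].
- apply filter_imp with (2 := H 0%nat). intros x Hx j Hj.
  now replace j with 0%nat by lia.
- apply filter_imp with (2 := filter_and _ _ IH (H (S n))). intros x [H1 H2] j Hj.
  destruct (Nat.eq_dec j (S n)) as [->|Hne]; [easy|]. apply H1. lia.
Qed.

(** The rows of the limit are the coordinatewise limits; as a block is
    finite-dimensional, these are also limits for its norm, which gives the
    distance to the limit as a bound uniform in the block. *)
Lemma c0_complete (F : (c0_sum -> Prop) -> Prop) :
  ProperFilter F -> @cauchy c0_UniformSpace F ->
  exists g : c0_sum, forall eps : posreal, F (@ball c0_UniformSpace g eps).
Proof.
intros HF HC.
set (G := fun n j => filtermap (fun f : c0_sum => f n j) F).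
assert (HG : forall n j, @cauchy C_CompleteNormedModule (G n j)).
{ intros n j eps. destruct (HC eps) as [f0 Hf0]. exists (f0 n j).
  apply filter_imp with (2 := Hf0). intros f Hf.
  apply C_NormedModule_mixin_compat1.
  eapply Rle_lt_trans; [|exact Hf].
  eapply Rle_trans; [|apply (coord_le _ n j)]. right. f_equal. simpl.
  unfold minus. change ((f n j + - f0 n j)%C = (f n j + - (1) * f0 n j)%C). ring. }
set (g := fun n j : nat => if le_dec j (D n)
  then @lim C_CompleteNormedModule (G n j) : C else RtoC 0).
assert (Hg : forall n j eps, 0 < eps -> (j <= D n)%nat ->
  F (fun f => Cmod (g n j - f n j)%C <= eps)).
{ intros n j eps Heps Hj.
  assert (Heps' : 0 < eps / sqrt 2) by (apply Rdiv_lt_0_compat; [easy|apply Rlt_sqrt2_0]).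
  assert (H := @complete_cauchy C_CompleteNormedModule (G n j)
    (filtermap_proper_filter _ _ _ F HF) (HG n j) (mkposreal _ Heps')).
  unfold G at 1, filtermap at 1 in H.
  revert H. apply filter_imp. intros f Hf.
  apply (C_NormedModule_mixin_compat2 _ _ (mkposreal _ Heps')) in Hf. simpl in Hf.
  unfold g. destruct (le_dec j (D n)) as [_|?]; [|easy].
  left. apply Rlt_le_trans with (sqrt 2 * (eps / sqrt 2)).
  - eapply Rle_lt_trans; [|exact Hf]. right.
    rewrite <- Cmod_opp. f_equal. unfold minus, plus, opp. simpl. ring_C.
  - right. field. assert (H0 := Rlt_sqrt2_0). lra. }
assert (Hdist : forall eps, 0 < eps ->
  F (fun f => forall n, N n (fun j => (g n j - f n j)%C) <= 3 * eps)).
{ intros eps Heps. destruct (HC (mkposreal _ Heps)) as [f0 Hf0].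
  apply filter_imp with (2 := Hf0). intros f Hf n.
  set (K := 1 + / P n * sum_n (fun j => (1 + / P n) ^ j) (D n)).
  assert (HK : 0 < K).
  { unfold K. apply Rplus_lt_le_0_compat; [lra|]. apply Rmult_le_pos.
    - left. apply Rinv_0_lt_compat, HP.
    - apply sum_n_ge0. intros j _. left. apply weight_gt0, HP. }
  assert (Hn : F (fun f' : c0_sum => forall j, (j <= D n)%nat -> (j <= D n)%nat ->
    Cmod (g n j - f' n j)%C <= eps / K)).
  { apply (filter_forall_le _ _ _ (fun j (f' : c0_sum) => (j <= D n)%nat -> _)).
    intros j. destruct (le_dec j (D n)) as [Hj|Hj].
    - apply filter_imp with (2 := Hg n j (eps / K) ltac:(now apply Rdiv_lt_0_compat) Hj).
      easy.
    - apply filter_forall. easy. }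
  destruct (filter_ex _ (filter_and _ _ Hn Hf0)) as [f' [Hf' Hf'0]].
  assert (H1 : N n (fun j => (g n j - f' n j)%C) <= eps).
  { eapply Rle_trans.
    - apply (block_norm_le_sup _ _ (HP n) _ (eps / K)). intros j Hj. now apply Hf'.
    - right. fold K. field. lra. }
  assert (H2 := row_norm_le (c0_plus f' (c0_opp f0)) n).
  assert (H3 := row_norm_le (c0_plus f0 (c0_opp f)) n).
  assert (H2' : c0_norm (c0_plus f' (c0_opp f0)) < eps) by exact Hf'0.
  assert (H3' : c0_norm (c0_plus f0 (c0_opp f)) < eps).
  { exact (UniformSpace.ax2 _ c0_UniformSpace_mixin f0 f _ Hf). }
  eapply Rle_trans.
  { apply (block_norm_triangle _ _ (HP n) (fun j => (g n j - f' n j)%C)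
      (c0_plus (c0_plus f' (c0_opp f0)) (c0_plus f0 (c0_opp f)) n)).
    intros j. simpl. ring_C. }
  assert (H4 : N n (c0_plus (c0_plus f' (c0_opp f0)) (c0_plus f0 (c0_opp f)) n)
    <= N n (c0_plus f' (c0_opp f0) n) + N n (c0_plus f0 (c0_opp f) n)).
  { now apply block_norm_triangle. }
  unfold N in *. lra. }
assert (Hsupp : forall n, supported (D n) (g n)).
{ intros n j Hj. unfold g. destruct (le_dec j (D n)); [lia|easy]. }
assert (Hc0 : forall eps, 0 < eps ->
  exists n0, forall n, (n0 <= n)%nat -> N n (g n) <= eps).
{ intros eps Heps.
  destruct (filter_ex _ (Hdist (eps / 6) ltac:(lra))) as [f Hf].
  destruct (row_vanishing f (eps / 2) ltac:(lra)) as [n0 Hn0].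
  exists n0. intros n Hn. specialize (Hf n). specialize (Hn0 n Hn).
  eapply Rle_trans.
  { apply (block_norm_triangle _ _ (HP n) (fun j => (g n j - f n j)%C) (f n)).
    intros j. ring. }
  unfold N in *. lra. }
exists (C0Sum g Hsupp Hc0). intros eps.
assert (Heps := cond_pos eps).
apply filter_imp with (2 := Hdist (eps / 6) ltac:(lra)). intros f Hf.
apply (UniformSpace.ax2 _ c0_UniformSpace_mixin f).
apply Rle_lt_trans with (3 * (eps / 6)); [|lra].
apply c0_norm_le. intros n. eapply Rle_trans; [|apply (Hf n)].
right. apply block_norm_ext. intros j. simpl. ring_C.
Qed.

Definition c0_CompleteSpace_mixin : CompleteSpace.mixin_of c0_UniformSpace.
Proof.
apply (CompleteSpace.Mixin c0_UniformSpace (fun F =>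
  epsilon (inhabits c0_zero)
    (fun g => forall eps : posreal, F (@ball c0_UniformSpace g eps)))).
- intros F HF HC.
  apply (epsilon_spec (inhabits c0_zero)
    (fun g => forall eps : posreal, F (@ball c0_UniformSpace g eps))).
  now apply c0_complete.
- intros F1 F2 H12 H21. replace F2 with F1; [apply close_refl|].
  apply functional_extensionality. intros A. apply propositional_extensionality.
  split; [apply H21|apply H12].
Defined.

Definition c0_space : CompleteNormedModule C_AbsRing :=
  CompleteNormedModule.Pack C_AbsRing c0_sum
    (CompleteNormedModule.Class C_AbsRing c0_sum
       c0_NormedModule_class c0_CompleteSpace_mixin)
    c0_sum.

End C0Sum.

(** * Poisson weights *)

Definition poisson (t : R) (j : nat) : R := exp (- t) * (t ^ j / INR (fact j)).

Lemma poisson_ge0 (t : R) (j : nat) : 0 <= t -> 0 <= poisson t j.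
Proof.
intros Ht. apply Rmult_le_pos; [left; apply exp_pos|].
apply Rmult_le_pos; [now apply pow_le|].
left. apply Rinv_0_lt_compat, INR_fact_lt_0.
Qed.

Lemma poisson_sum (t : R) : is_series (poisson t) 1.
Proof.
replace 1 with (exp (- t) * exp t) by (rewrite <- exp_plus, <- exp_0; f_equal; ring).
apply (is_series_scal_l (V := R_NormedModule)).
apply is_series_ext with (2 := is_exp_Reals t). intros j.
change (pow_n t j * / INR (fact j) = t ^ j / INR (fact j)). now rewrite pow_n_pow.
Qed.

Lemma poisson_partial_sum_le1 (t : R) (n : nat) :
  0 <= t -> sum_n (poisson t) n <= 1.
Proof.
intros Ht. rewrite sum_n_Reals. apply sum_incr.
- apply is_series_Reals, poisson_sum.
- intros j. now apply poisson_ge0.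
Qed.

Lemma poisson_conv (s t : R) (l : nat) :
  sum_n (fun i => poisson s i * poisson t (l - i)) l = poisson (s + t) l.
Proof.
unfold poisson at 3. rewrite binomial, Ropp_plus_distr, exp_plus.
unfold Rdiv at 1. rewrite (Rmult_comm (sum_f_R0 _ _)), <- sum_n_Reals.
rewrite <- !sum_n_Rmult_l. apply sum_n_ext_loc. intros i Hi.
unfold poisson, Binomial.C.
match goal with |- @eq _ ?a ?b => change (@eq R a b) end.
field. repeat split; apply INR_fact_neq_0.
Qed.

Lemma poisson_S (t : R) (j : nat) :
  INR (S j) * poisson t (S j) = t * poisson t j.
Proof.
unfold poisson. rewrite fact_simpl, mult_INR. simpl pow.
field. split; [apply INR_fact_neq_0|]. now apply not_0_INR.
Qed.

(** The closed form of the partial sums of the second central moment minus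
    [t]; past [n = t] it is negative, so no partial variance exceeds [t] there. *)
Lemma poisson_second_moment (t : R) (n : nat) :
  sum_n (fun j => poisson t j * ((INR j - t) ^ 2 - t)) n
  = - t * (INR (S n) - t) * poisson t n.
Proof.
induction n as [|n IH].
- rewrite sum_O. simpl. ring_R.
- rewrite sum_Sn, IH.
  change (- t * (INR (S n) - t) * poisson t n
    + poisson t (S n) * ((INR (S n) - t) ^ 2 - t)
    = - t * (INR (S (S n)) - t) * poisson t (S n)).
  assert (H := poisson_S t n). rewrite (S_INR (S n)).
  replace (- t * (INR (S n) - t) * poisson t n)
    with (- (INR (S n) - t) * (t * poisson t n)) by ring.
  rewrite <- H. ring.
Qed.

Lemma poisson_variance_le (t : R) (n : nat) :
  0 <= t -> t <= INR n ->
  sum_n (fun j => poisson t j * (INR j - t) ^ 2) n <= t.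
Proof.
intros Ht Hn. assert (H := poisson_second_moment t n).
assert (E : sum_n (fun j => poisson t j * (INR j - t) ^ 2) n
  = sum_n (fun j => poisson t j * ((INR j - t) ^ 2 - t)) n
    + t * sum_n (poisson t) n).
{ rewrite <- sum_n_Rmult_l, <- sum_n_Rplus. apply sum_n_ext. intros j. ring_R. }
rewrite E, H. rewrite S_INR.
assert (H1 := poisson_partial_sum_le1 t n Ht).
assert (H2 := poisson_ge0 t n Ht).
assert (0 <= t * (INR n + 1 - t) * poisson t n).
{ apply Rmult_le_pos; [|easy]. apply Rmult_le_pos; lra. }
assert (t * sum_n (poisson t) n <= t * 1) by now apply Rmult_le_compat_l.
lra.
Qed.

Definition near (t : R) (j : nat) : R :=
  if Rle_dec (Rabs (INR j - t)) (2 * sqrt t) then 1 else 0.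

(** Chebyshev's inequality: the weights outside the interval where [near t] is 1
    add up to at most [t / (2 sqrt t)^2]. *)
Lemma poisson_concentration (t : R) (n : nat) :
  0 < t -> t <= INR n ->
  sum_n (poisson t) n - / 4 <= sum_n (fun j => poisson t j * near t j) n.
Proof.
intros Ht Hn.
assert (H := poisson_variance_le t n (Rlt_le _ _ Ht) Hn).
apply Rle_trans with
  (sum_n (poisson t) n
   + - / (4 * t) * sum_n (fun j => poisson t j * (INR j - t) ^ 2) n).
- assert (0 < / (4 * t)) by (apply Rinv_0_lt_compat; lra).
  apply (Rmult_le_compat_l (/ (4 * t))) in H; [|lra].
  replace (/ (4 * t) * t) with (/ 4) in H by (field; lra). lra.
- rewrite <- sum_n_Rmult_l, <- sum_n_Rplus. apply sum_n_le. intros j _.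
  assert (Hp := poisson_ge0 t j (Rlt_le _ _ Ht)).
  replace (poisson t j + - / (4 * t) * (poisson t j * (INR j - t) ^ 2))
    with (poisson t j * (1 - (INR j - t) ^ 2 / (4 * t))) by (field; lra).
  apply Rmult_le_compat_l; [easy|].
  assert (H0 : 0 <= (INR j - t) ^ 2 / (4 * t)).
  { apply Rdiv_le_0_compat; [apply pow2_ge_0|lra]. }
  unfold near. destruct (Rle_dec _ _) as [Hj|Hj]; [lra|].
  apply Rnot_le_lt in Hj.
  assert (1 <= (INR j - t) ^ 2 / (4 * t)); [|lra].
  apply Rle_div_r; [lra|]. rewrite Rmult_1_l, <- pow2_abs.
  rewrite <- (sqrt_sqrt t) at 1 by lra.
  assert (0 <= sqrt t) by apply sqrt_pos. nra.
Qed.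

Lemma near_count (t : R) (n : nat) :
  0 <= t -> sum_n (near t) n <= 4 * sqrt t + 1.
Proof.
intros Ht. set (a := t - 2 * sqrt t). set (b := t + 2 * sqrt t).
assert (Hs : 0 <= sqrt t) by apply sqrt_pos.
assert (Hnear : forall j, near t j = 1 /\ a <= INR j <= b
  \/ near t j = 0 /\ (INR j < a \/ b < INR j)).
{ intros j. unfold near, a, b. destruct (Rle_dec _ _) as [H|H].
  - left. apply Rabs_le_between in H. lra.
  - right. split; [easy|]. apply Rnot_le_lt in H. unfold Rabs in H.
    destruct (Rcase_abs _) in H; lra. }
(* The count up to [n] only sees the part of [a, b] to the left of [n]. *)
assert (H : sum_n (near t) n <= Rmax 0 (Rmin (INR n) b - a + 1)).
{ induction n as [|n IH].
  - rewrite sum_O. destruct (Hnear 0%nat) as [[-> H]|[-> H]]; [|apply Rmax_l].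
    simpl in H. simpl. rewrite Rmin_left by lra.
    eapply Rle_trans; [|apply Rmax_r]. lra.
  - rewrite sum_Sn. change plus with Rplus.
    rewrite S_INR. destruct (Hnear (S n)) as [[-> H]|[-> H]].
    + rewrite S_INR in H. rewrite Rmin_left in IH by lra.
      rewrite Rmin_left by lra. rewrite Rmax_right by lra.
      revert IH. apply Rmax_case_strong; intros; lra.
    + rewrite Rplus_0_r. eapply Rle_trans; [apply IH|].
      apply Rmax_lub; [apply Rmax_l|]. eapply Rle_trans; [|apply Rmax_r].
      assert (Rmin (INR n) b <= Rmin (INR n + 1) b); [|lra].
      apply Rle_min_compat_r. lra. }
eapply Rle_trans; [exact H|]. apply Rmax_lub; [lra|].
assert (H0 := Rmin_r (INR n) b). unfold a, b in *. lra.
Qed.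

(** * Coefficients of the semigroup, its generator and the resolvent *)

Definition cis (x : R) : C := (cos x, sin x).

Lemma cis_plus (x y : R) : cis (x + y) = Cmult (cis x) (cis y).
Proof. unfold cis, Cmult. simpl. rewrite cos_plus, sin_plus. f_equal; ring. Qed.

Lemma Cmod_cis (x : R) : Cmod (cis x) = 1.
Proof.
unfold Cmod. simpl. rewrite !Rmult_1_r, Rplus_comm.
change (sqrt (Rsqr (sin x) + Rsqr (cos x)) = 1). now rewrite sin2_cos2, sqrt_1.
Qed.

(** The coefficients of [exp (t (i r - 1 + S))]. *)
Definition semigroup_coef (r t : R) (j : nat) : C :=
  Cmult (cis (r * t)) (RtoC (poisson t j)).

Definition generator_coef (r : R) (j : nat) : C :=
  match j with O => (-1, r) | S O => 1 | _ => 0 end.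

(** The coefficients of [1 / (i s - (i r - 1 + S))]. *)
Definition resolvent_coef (r s : R) (j : nat) : C := Cpow (Cinv (1%R, (s - r)%R)) (S j).

Lemma Cmod_semigroup_coef (r t : R) (j : nat) :
  0 <= t -> Cmod (semigroup_coef r t j) = poisson t j.
Proof.
intros Ht. unfold semigroup_coef. rewrite Cmod_mult, Cmod_cis, Cmod_R.
rewrite Rabs_pos_eq; [ring|now apply poisson_ge0].
Qed.

Lemma semigroup_coef_0 (r : R) (j : nat) : semigroup_coef r 0 j = delta0 j.
Proof.
unfold semigroup_coef, cis, poisson.
rewrite Rmult_0_r, cos_0, sin_0, Ropp_0, exp_0. destruct j as [|j]; simpl.
- unfold Cmult, RtoC. simpl. f_equal; field.
- unfold Cmult, RtoC. simpl. f_equal; field; apply (INR_fact_neq_0 (S j)).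
Qed.

Lemma semigroup_coef_conv (r s t : R) (l : nat) :
  conv (semigroup_coef r s) (semigroup_coef r t) l = semigroup_coef r (s + t) l.
Proof.
unfold conv, semigroup_coef at 3.
rewrite <- poisson_conv, RtoC_sum_n, Rmult_plus_distr_l, cis_plus, <- sum_n_Cmult_l.
apply sum_n_ext. intros i. unfold semigroup_coef. rewrite RtoC_mult. ring_C.
Qed.

Lemma resolvent_coef_conv (r s : R) (l : nat) :
  conv (fun j => Cplus (Cmult (0%R, s) (delta0 j)) (Copp (generator_coef r j)))
    (resolvent_coef r s) l = delta0 l.
Proof.
set (z := (1, s - r) : C).
assert (Hz : z <> RtoC 0) by (intros E; injection E; lra).
assert (H1 : (((0%R, s) : C) * 1 + - ((-1)%R, r))%C = z).
{ unfold z, Cplus, Cmult, Copp, RtoC. simpl. f_equal; ring. }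
unfold conv, resolvent_coef. fold z. destruct l as [|l].
- rewrite sum_O. simpl delta0. simpl generator_coef. rewrite H1.
  simpl Cpow. field. easy.
- rewrite (sum_n_truncate C_AbelianMonoid _ 1); [|lia|].
  + rewrite sum_Sn, sum_O. simpl delta0. simpl generator_coef. rewrite H1.
    rewrite Nat.sub_0_r. replace (S l - 1)%nat with l by lia.
    simpl Cpow.
    change (@plus C_AbelianMonoid) with Cplus. field. easy.
  + intros [|[|j]] Hj; [lia|lia|].
    simpl delta0. simpl generator_coef.
    change (@zero C_AbelianMonoid) with (RtoC 0). ring_C.
Qed.

Lemma semigroup_coef_derivative (r : R) (j : nat) (eps : posreal) :
  at_right 0 (fun h =>
    Cmod (RtoC (/ h) * (semigroup_coef r h j - delta0 j) - generator_coef r j)%C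
    < eps).
Proof.
assert (Hquot : forall (f : R -> R) (l : R), is_derive f 0 l ->
  at_right 0 (fun h => Rabs (/ h * (f h - f 0) - l) < eps / 2)).
{ intros f l Hf. apply is_derive_Reals in Hf.
  destruct (Hf (eps / 2)) as [d Hd]; [assert (H := cond_pos eps); lra|].
  exists d. intros h Hh Hh0. specialize (Hd h).
  change (Rabs (h - 0) < d) in Hh. rewrite Rminus_0_r in Hh.
  rewrite Rplus_0_l in Hd.
  replace (/ h * (f h - f 0)) with ((f h - f 0) / h) by (unfold Rdiv; ring).
  apply Hd; [lra|easy]. }
assert (Hp : is_derive (fun h => poisson h j) 0 (Re (generator_coef r j))).
{ unfold poisson. destruct j as [|[|j]]; simpl generator_coef.
  - simpl. auto_derive; [easy|]. rewrite Ropp_0, exp_0. field.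
  - simpl. auto_derive; [easy|]. rewrite Ropp_0, exp_0. field.
  - auto_derive; [easy|]. rewrite Ropp_0, exp_0. simpl. field.
    apply (INR_fact_neq_0 (S (S j))). }
assert (Hp0 : poisson 0 j = Re (delta0 j)).
{ rewrite <- (semigroup_coef_0 0). unfold semigroup_coef, cis.
  rewrite Rmult_0_r, cos_0, sin_0. simpl. ring. }
assert (Hre : is_derive (fun h => cos (r * h) * poisson h j) 0
  (Re (generator_coef r j))).
{ replace (Re (generator_coef r j))
    with (- (r * sin (r * 0)) * poisson 0 j + cos (r * 0) * Re (generator_coef r j)).
  - apply (is_derive_mult (fun h => cos (r * h)) (fun h => poisson h j));
      [|exact Hp|intros; apply Rmult_comm].
    auto_derive; [easy|ring].
  - rewrite Rmult_0_r, cos_0, sin_0. ring. }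
assert (Him : is_derive (fun h => sin (r * h) * poisson h j) 0
  (Im (generator_coef r j))).
{ replace (Im (generator_coef r j))
    with (r * cos (r * 0) * poisson 0 j + sin (r * 0) * Re (generator_coef r j)).
  - apply (is_derive_mult (fun h => sin (r * h)) (fun h => poisson h j));
      [|exact Hp|intros; apply Rmult_comm].
    auto_derive; [easy|ring].
  - rewrite Rmult_0_r, cos_0, sin_0, Hp0. destruct j as [|[|j]]; simpl; ring. }
generalize (filter_and _ _ (Hquot _ _ Hre) (Hquot _ _ Him)).
apply filter_imp. intros h [H1 H2].
rewrite Rmult_0_r, cos_0, Hp0 in H1. rewrite Rmult_0_r, sin_0, Hp0 in H2.
set (x := / h * (cos (r * h) * poisson h j - 1 * Re (delta0 j))
  - Re (generator_coef r j)) in *.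
set (y := / h * (sin (r * h) * poisson h j - 0 * Re (delta0 j))
  - Im (generator_coef r j)) in *.
assert (E : (RtoC (/ h) * (semigroup_coef r h j - delta0 j) - generator_coef r j)%C
  = (RtoC x + Ci * RtoC y)%C).
{ unfold x, y, semigroup_coef, cis, RtoC, Ci, Cminus, Cplus, Cmult, Copp, Re, Im.
  destruct j; simpl; f_equal; ring. }
rewrite E. eapply Rle_lt_trans; [apply Cmod_triangle|].
rewrite Cmod_mult, Cmod_Ci, !Cmod_R. lra.
Qed.

(** * Estimates in one block *)

Lemma geometric_partial_sum_le (x : R) (n : nat) :
  0 <= x < 1 -> sum_n (fun j => x ^ j) n <= / (1 - x).
Proof.
intros Hx. rewrite sum_n_Reals, tech3 by lra.
rewrite <- (Rmult_1_l (/ (1 - x))). apply Rmult_le_compat_r.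
- left. apply Rinv_0_lt_compat. lra.
- assert (0 <= x ^ S n) by (apply pow_le; lra). lra.
Qed.

Section OneBlock.

Variables (D : nat) (P r : R).
Hypothesis HP : 0 < P.

Let N : (nat -> C) -> R := block_norm D P.
Let T (t : R) : (nat -> C) -> nat -> C := shift_series D (semigroup_coef r t).
Let A : (nat -> C) -> nat -> C := shift_series D (generator_coef r).
Let Rs (s : R) : (nat -> C) -> nat -> C := shift_series D (resolvent_coef r s).

(** The shift is a contraction and the Poisson weights sum to at most 1. *)
Lemma block_semigroup_contraction (t : R) (v : nat -> C) :
  0 <= t -> supported D v -> N (T t v) <= N v.
Proof.
intros Ht Hv. rewrite <- (Rmult_1_l (N v)).
eapply Rle_trans; [now apply block_norm_shift_series|].
apply Rmult_le_compat_r; [now apply block_norm_ge0|].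
rewrite (sum_n_ext _ (poisson t)).
- now apply poisson_partial_sum_le1.
- intros j. now apply Cmod_semigroup_coef.
Qed.

Lemma block_generator_bound (v : nat -> C) :
  0 <= r -> supported D v -> N (A v) <= (r + 2) * N v.
Proof.
intros Hr Hv. eapply Rle_trans; [now apply block_norm_shift_series|].
apply Rmult_le_compat_r; [now apply block_norm_ge0|].
assert (H0 : Cmod (generator_coef r 0) <= 1 + r).
{ replace (generator_coef r 0) with (RtoC (-1) + Ci * RtoC r)%C.
  - eapply Rle_trans; [apply Cmod_triangle|].
    rewrite Cmod_mult, Cmod_Ci, !Cmod_R, Rabs_left, Rabs_pos_eq; lra.
  - unfold Cplus, Cmult, Ci, RtoC. simpl. f_equal; ring. }
apply Rle_trans with (sum_n (fun j => Cmod (generator_coef r j)) (S D)).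
{ rewrite sum_Sn. change plus with Rplus.
  assert (H := Cmod_ge_0 (generator_coef r (S D))). lra. }
rewrite sum_n_S_l. change plus with Rplus.
rewrite (sum_n_truncate R_AbelianMonoid _ 0).
- rewrite sum_O. change (Cmod (generator_coef r 1)) with (Cmod 1).
  rewrite Cmod_1. lra.
- lia.
- intros [|j] Hj; [lia|]. apply Cmod_0.
Qed.

Let Cmod_line (u : R) : Cmod (1%R, u) = sqrt (1 + u ^ 2).
Proof. unfold Cmod. simpl. f_equal. ring. Qed.

Let line_neq0 (u : R) : (1%R, u) <> RtoC 0.
Proof. intros E. injection E. lra. Qed.

Let Cmod_resolvent_coef (s : R) (j : nat) :
  Cmod (resolvent_coef r s j) = / sqrt (1 + (s - r) ^ 2) ^ S j.
Proof.
unfold resolvent_coef. rewrite Cmod_pow, Cmod_inv by apply line_neq0.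
now rewrite Cmod_line, pow_inv.
Qed.

(** The sup-part of the resolvent is controlled by the weighted sum, and on the
    weighted sum the shift has norm [1 / (1 + 1/P)], so that the Neumann series
    costs at most [P + 1] there. *)
Lemma block_resolvent_bound (s : R) (v : nat -> C) :
  supported D v -> N (Rs s v) <= (2 * P + 1) * N v.
Proof.
intros Hv.
assert (HP' : 0 < / P) by now apply Rinv_0_lt_compat.
assert (Hc : forall j, Cmod (resolvent_coef r s j) <= 1).
{ intros j. rewrite Cmod_resolvent_coef, <- Rinv_1.
  apply Rinv_le_contravar; [lra|]. apply pow_R1_Rle.
  rewrite <- sqrt_1 at 1. apply sqrt_le_1_alt.
  assert (H := pow2_ge_0 (s - r)). lra. }
assert (H1 := max_abs_shift_series_weighted D P HP _ v Hv Hc).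
assert (H2 := weighted_sum_shift_series D P HP (resolvent_coef r s) v Hv).
assert (H3 : sum_n (fun j => Cmod (resolvent_coef r s j) * / (1 + / P) ^ j) D
  <= P + 1).
{ apply Rle_trans with (sum_n (fun j => (/ (1 + / P)) ^ j) D).
  - apply sum_n_le. intros j _. rewrite pow_inv.
    rewrite <- (Rmult_1_l (/ (1 + / P) ^ j)) at 2.
    apply Rmult_le_compat_r; [|apply Hc].
    left. now apply Rinv_0_lt_compat, weight_gt0.
  - eapply Rle_trans.
    + apply geometric_partial_sum_le. split.
      * left. apply Rinv_0_lt_compat. lra.
      * rewrite <- Rinv_1. apply Rinv_lt_contravar; lra.
    + right. field. lra. }
assert (H4 := weighted_sum_ge0 D P HP v). assert (H5 := max_abs_ge0 D v).
unfold N, Rs, block_norm.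
assert (H6 : weighted_sum D P (shift_series D (resolvent_coef r s) v)
  <= (P + 1) * weighted_sum D P v).
{ eapply Rle_trans; [exact H2|]. now apply Rmult_le_compat_r. }
apply (Rmult_le_compat_l (/ P)) in H6; [|lra].
assert (0 <= / P * weighted_sum D P v) by (apply Rmult_le_pos; lra).
replace (weighted_sum D P v) with (P * (/ P * weighted_sum D P v)) in H1
  by (field; lra).
nra.
Qed.

(** Away from the spectral frequency the Neumann series converges at the rate
    [1 / |1 + i (s - r)| <= 3/4], whatever [P] is. *)
Lemma block_resolvent_bound_far (s : R) (v : nat -> C) :
  1 <= Rabs (s - r) -> supported D v -> N (Rs s v) <= 3 * N v.
Proof.
intros Hs Hv. eapply Rle_trans; [now apply block_norm_shift_series|].
apply Rmult_le_compat_r; [now apply block_norm_ge0|].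
assert (Hq : / sqrt (1 + (s - r) ^ 2) <= 3 / 4).
{ replace (3 / 4) with (/ (4 / 3)) by field. apply Rinv_le_contravar; [lra|].
  rewrite <- (sqrt_pow2 (4 / 3)) by lra. apply sqrt_le_1_alt.
  rewrite <- (pow2_abs (s - r)). nra. }
assert (Hq0 : 0 <= / sqrt (1 + (s - r) ^ 2)).
{ left. apply Rinv_0_lt_compat, sqrt_lt_R0.
  assert (H := pow2_ge_0 (s - r)). lra. }
apply Rle_trans with (sum_n (fun j => 3 / 4 * (3 / 4) ^ j) D).
- apply sum_n_le. intros j _. rewrite Cmod_resolvent_coef, <- pow_inv.
  change (3 / 4 * (3 / 4) ^ j) with ((3 / 4) ^ S j). now apply pow_incr.
- rewrite sum_n_Rmult_l. eapply Rle_trans.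
  + apply Rmult_le_compat_l; [lra|]. apply geometric_partial_sum_le. lra.
  + right. field.
Qed.

Lemma block_generator_quotient (v : nat -> C) (eps : R) :
  supported D v -> 0 < eps ->
  at_right 0 (fun h =>
    N (fun k => RtoC (/ h) * (T h v k - v k) - A v k)%C <= eps).
Proof.
intros Hv Heps.
set (c := fun h j =>
  (RtoC (/ h) * (semigroup_coef r h j - delta0 j) - generator_coef r j)%C).
assert (Hc : forall eta : posreal,
  at_right 0 (fun h => sum_n (fun j => Cmod (c h j)) D <= INR (S D) * eta)).
{ intros eta.
  generalize (filter_forall_le _ (at_right 0) _ _ D
    (fun j => semigroup_coef_derivative r j eta)).
  apply filter_imp. intros h Hh. rewrite <- sum_n_const. apply sum_n_le.
  intros j Hj. left. now apply Hh. }
assert (HN := block_norm_ge0 D P HP v). fold N in HN.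
assert (HD : 0 < INR (S D)) by (apply lt_0_INR; lia).
assert (Heta : 0 < eps / (INR (S D) * (N v + 1))).
{ apply Rdiv_lt_0_compat; [easy|]. apply Rmult_lt_0_compat; lra. }
generalize (Hc (mkposreal _ Heta)). apply filter_imp. simpl pos. intros h Hh.
unfold N at 1. rewrite (block_norm_ext D P _ (shift_series D (c h) v)).
- eapply Rle_trans; [now apply block_norm_shift_series|]. fold N.
  apply Rle_trans with
    (INR (S D) * (eps / (INR (S D) * (N v + 1))) * (N v + 1)).
  + apply Rmult_le_compat; [|easy|easy|lra].
    apply sum_n_ge0. intros j _. apply Cmod_ge_0.
  + right. field. lra.
- intros k. unfold c, Cminus, T, A.
  rewrite shift_series_plus_l, shift_series_scal_l, shift_series_plus_l.
  f_equal; [f_equal; f_equal|].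
  + rewrite <- (shift_series_delta0 D v k) at 1.
    rewrite <- (Cmult_1_l (shift_series D (fun j => (- delta0 j)%C) v k)).
    rewrite (shift_series_ext D (fun j => (- delta0 j)%C)
      (fun j => (- (1) * delta0 j)%C) v v).
    * rewrite shift_series_scal_l. ring.
    * intros j. ring.
    * easy.
  + rewrite (shift_series_ext D (fun j => (- generator_coef r j)%C)
      (fun j => (- (1) * generator_coef r j)%C) v v).
    * rewrite shift_series_scal_l. ring.
    * intros j. ring.
    * easy.
Qed.

Lemma block_semigroup_supported (t : R) (v : nat -> C) :
  supported D v -> supported D (T t v).
Proof. apply shift_series_supported. Qed.

Lemma block_semigroup_plus (s t : R) (v : nat -> C) (k : nat) :
  supported D v -> T (s + t) v k = T s (T t v) k.
Proof.
intros Hv. unfold T. rewrite shift_series_comp by easy.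
apply shift_series_ext; [|easy]. intros j. now rewrite semigroup_coef_conv.
Qed.

Lemma block_semigroup_0 (v : nat -> C) (k : nat) : T 0 v k = v k.
Proof.
unfold T. rewrite <- (shift_series_delta0 D v k) at 1.
apply shift_series_ext; [|easy]. intros j. apply semigroup_coef_0.
Qed.

(** Contractivity turns the derivative at 0 into a global Lipschitz bound:
    subdivide [0, h] into [m] steps, each of which moves the orbit by no more
    than the first one does, and let [m] tend to infinity. *)
Lemma block_semigroup_lipschitz (h : R) (v : nat -> C) :
  0 <= h -> supported D v -> N (fun k => T h v k - v k)%C <= h * N (A v).
Proof.
intros Hh Hv.
assert (Hsub : forall d m, 0 <= d ->
  N (fun k => T (INR m * d) v k - v k)%C
  <= INR m * N (fun k => T d v k - v k)%C).
{ intros d m Hd. induction m as [|m IH].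
  - simpl INR. rewrite !Rmult_0_l. unfold N.
    rewrite (block_norm_ext D P _ (fun _ => 0 * v O)%C).
    + eapply Rle_trans.
      * apply block_norm_scal with (a := RtoC 0) (v := fun _ => v O). easy.
      * rewrite Cmod_0. lra.
    + intros k. rewrite block_semigroup_0. ring.
  - rewrite S_INR.
    set (w := fun k => (T d v k - v k)%C) in *.
    assert (Hw : supported D w).
    { intros j Hj. unfold w.
      rewrite block_semigroup_supported by easy. rewrite Hv by easy. ring. }
    eapply Rle_trans.
    + apply (block_norm_triangle D P HP (T (INR m * d) w)
        (fun k => T (INR m * d) v k - v k)%C).
      intros k. unfold w, Cminus, T. rewrite shift_series_plus_r.
      fold (T d v). fold (T (INR m * d) (T d v)).
      rewrite <- block_semigroup_plus by easy.
      rewrite (shift_series_ext D _ (semigroup_coef r (INR m * d))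
        (fun j => (- v j)%C) (fun j => (- (1) * v j)%C)).
      * rewrite shift_series_scal_r. fold (T (INR m * d) v).
        replace ((INR m + 1) * d) with (INR m * d + d) by ring.
        fold (T (INR m * d + d) v). ring.
      * easy.
      * intros j. ring.
    + assert (H := block_semigroup_contraction (INR m * d) w
        (Rmult_le_pos _ _ (pos_INR m) Hd) Hw).
      unfold N in *. lra. }
destruct Hh as [Hh|<-].
2: { assert (H := Hsub 0 0%nat (Rle_refl 0)). simpl INR in H.
     rewrite !Rmult_0_l in H. lra. }
apply Rnot_lt_le. intros Hlt.
set (e := (N (fun k => T h v k - v k)%C - h * N (A v)) / (2 * h)).
assert (He : 0 < e) by (apply Rdiv_lt_0_compat; lra).
destruct (block_generator_quotient v e Hv He) as [eta Heta].
destruct (nfloor_ex (h / eta)) as [m Hm].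
{ apply Rdiv_le_0_compat; [lra|apply cond_pos]. }
set (d := h / INR (S m)).
assert (Hm0 : 0 < INR (S m)) by (apply lt_0_INR; lia).
assert (Hd : 0 < d) by now apply Rdiv_lt_0_compat.
assert (Hdeta : d < eta).
{ assert (H := cond_pos eta). unfold d. apply Rlt_div_l; [easy|].
  rewrite Rmult_comm. apply Rlt_div_l; [easy|]. rewrite S_INR. lra. }
assert (Hq : N (fun k => RtoC (/ d) * (T d v k - v k) - A v k)%C <= e).
{ apply Heta; [|easy]. change (Rabs (d - 0) < eta).
  rewrite Rminus_0_r, Rabs_pos_eq; lra. }
assert (H1 := Hsub d (S m) (Rlt_le _ _ Hd)).
replace (INR (S m) * d) with h in H1 by (unfold d; field; lra).
assert (H2 : N (fun k => T d v k - v k)%C <= d * (N (A v) + e)).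
{ eapply Rle_trans.
  - apply (block_norm_scal D P (RtoC d) (fun k => RtoC (/ d) * (T d v k - v k))%C).
    intros k. rewrite Cmult_assoc, <- RtoC_mult, Rinv_r, Cmult_1_l by lra. easy.
  - rewrite Cmod_R, Rabs_pos_eq by lra. apply Rmult_le_compat_l; [lra|].
    eapply Rle_trans.
    + apply (block_norm_triangle D P HP (A v)
        (fun k => RtoC (/ d) * (T d v k - v k) - A v k)%C).
      intros k. ring.
    + unfold N in *. lra. }
apply (Rmult_le_compat_l (INR (S m))) in H2; [|lra].
replace (INR (S m) * (d * (N (A v) + e))) with (h * N (A v) + h * e) in H2
  by (unfold d; field; lra).
replace (h * e) with ((N (fun k => T h v k - v k)%C - h * N (A v)) / 2) in H2
  by (unfold e; field; lra).
lra.
Qed.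

End OneBlock.

(** * The semigroup on the sum of the blocks *)

Section SumOfBlocks.

Variables (D : nat -> nat) (P r : nat -> R).
Hypothesis HP : forall n, 0 < P n.

Let N (n : nat) : (nat -> C) -> R := block_norm (D n) (P n).
Let X : CompleteNormedModule C_AbsRing := c0_space D P HP.

Definition uniformly_bounded (c : nat -> nat -> C) (K : R) : Prop :=
  forall n v, supported (D n) v ->
    N n (shift_series (D n) (c n) v) <= K * N n v.

Definition c0_series (c : nat -> nat -> C) (K : R) (HK : 0 < K)
  (Hc : uniformly_bounded c K) (f : c0_sum D P) : c0_sum D P.
Proof.
refine (C0Sum D P (fun n => shift_series (D n) (c n) (f n)) _ _).
- intros n. apply shift_series_supported, row_supported.
- intros eps Heps. destruct (row_vanishing D P f (eps / K)) as [n0 H0].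
  { now apply Rdiv_lt_0_compat. }
  exists n0. intros n Hn.
  eapply Rle_trans; [apply Hc, row_supported|].
  apply Rle_trans with (K * (eps / K)); [|right; field; lra].
  apply Rmult_le_compat_l; [lra|now apply H0].
Defined.

Lemma c0_series_linear (c : nat -> nat -> C) (K : R) (HK : 0 < K)
  (Hc : uniformly_bounded c K) :
  @is_linear C_AbsRing X X (c0_series c K HK Hc).
Proof.
split.
- intros f g. apply c0_sum_ext. intros n j. apply shift_series_plus_r.
- intros a f. apply c0_sum_ext. intros n j. apply shift_series_scal_r.
- exists K. split; [easy|]. intros f. apply c0_norm_le. intros n.
  eapply Rle_trans; [apply Hc, row_supported|].
  apply Rmult_le_compat_l; [lra|]. apply (row_norm_le D P f n).
Qed.

Lemma semigroup_uniformly_bounded (t : R) :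
  uniformly_bounded (fun n => semigroup_coef (r n) (Rmax 0 t)) 1.
Proof.
intros n v Hv. rewrite Rmult_1_l.
apply block_semigroup_contraction; [apply HP|apply Rmax_l|easy].
Qed.

Definition block_sum_semigroup (t : R) : X -> X :=
  c0_series _ 1 Rlt_0_1 (semigroup_uniformly_bounded t).

Lemma block_sum_semigroupE (t : R) (f : X) (n j : nat) : 0 <= t ->
  row D P (block_sum_semigroup t f) n j
  = shift_series (D n) (semigroup_coef (r n) t) (row D P f n) j.
Proof. intros Ht. simpl. now rewrite Rmax_right. Qed.

Lemma block_sum_semigroup_row (t : R) (f : X) (n : nat) :
  N n (row D P (block_sum_semigroup t f) n) <= N n (row D P f n).
Proof.
assert (H := semigroup_uniformly_bounded t n (row D P f n) (row_supported _ _ f n)).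
rewrite Rmult_1_l in H. exact H.
Qed.

(** Past some index the dominating rows [w n] are small; the finitely many blocks
    before it are treated one at a time. *)
Lemma c0_filterlim (F : (R -> Prop) -> Prop) (HF : Filter F)
  (g : R -> X) (y w : X) (B : R) : 0 < B ->
  (forall n eps, 0 < eps -> F (fun h =>
    N n (fun j => row D P (g h) n j - row D P y n j)%C <= eps)) ->
  F (fun h => forall n,
    N n (fun j => row D P (g h) n j - row D P y n j)%C <= B * N n (row D P w n)) ->
  filterlim g F (locally y).
Proof.
intros HB Hrow Hdom. apply filterlim_locally. intros eps.
assert (Heps := cond_pos eps).
destruct (row_vanishing D P w (eps / (2 * B))) as [n0 Hn0].
{ apply Rdiv_lt_0_compat; lra. }
generalize (filter_and _ _ Hdom
  (filter_forall_le _ _ HF _ n0 (fun n => Hrow n (eps / 2) ltac:(lra)))).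
apply filter_imp. intros h [H1 H2].
apply Rle_lt_trans with (eps / 2); [|lra]. apply c0_norm_le. intros n.
rewrite (block_norm_ext _ _ _ (fun j => row D P (g h) n j - row D P y n j)%C).
- destruct (Nat.le_gt_cases n n0) as [Hn|Hn]; [now apply H2|].
  eapply Rle_trans; [apply H1|].
  apply Rle_trans with (B * (eps / (2 * B))); [|right; field; lra].
  apply Rmult_le_compat_l; [lra|]. apply Hn0. lia.
- intros j. simpl. ring_C.
Qed.

Lemma filterlim_row (F : (R -> Prop) -> Prop) (HF : Filter F)
  (g : R -> X) (y : X) (n : nat) (eps : R) : 0 < eps ->
  filterlim g F (locally y) ->
  F (fun h => N n (fun j => row D P (g h) n j - row D P y n j)%C <= eps).
Proof.
intros Heps Hg.
generalize (proj1 (@filterlim_locally R X F HF g y) Hg (mkposreal _ Heps)).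
apply filter_imp. intros h Hh. left. eapply Rle_lt_trans; [|exact Hh].
eapply Rle_trans; [|apply (row_norm_le D P _ n)]. right.
apply block_norm_ext. intros j. simpl. ring_C.
Qed.

(** The domain of the generator consists of all [x] for which the blockwise
    generator stays in the c_0-sum: the Lipschitz bound on the orbits dominates
    the difference quotients by the rows of [y]. *)
Lemma block_sum_generator (x y : X) :
  generator block_sum_semigroup x y <->
  forall n j, row D P y n j
    = shift_series (D n) (generator_coef (r n)) (row D P x n) j.
Proof.
set (g := fun h => scal (RtoC (/ h)) (minus (block_sum_semigroup h x) x)).
assert (Hg : forall h n j, 0 < h -> row D P (g h) n j
  = (RtoC (/ h) * (shift_series (D n) (semigroup_coef (r n) h) (row D P x n) j
      - row D P x n j))%C).
{ intros h n j Hh. rewrite <- block_sum_semigroupE by lra. simpl. ring_C. }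
assert (Hpos : at_right 0 (fun h => 0 < h)).
{ exists (mkposreal 1 Rlt_0_1). easy. }
assert (Hq : forall n eps, 0 < eps -> at_right 0 (fun h =>
  N n (fun j => row D P (g h) n j
    - shift_series (D n) (generator_coef (r n)) (row D P x n) j)%C <= eps)).
{ intros n eps Heps.
  generalize (filter_and _ _ Hpos (block_generator_quotient (D n) (P n) (r n)
    (HP n) (row D P x n) eps (row_supported _ _ _ n) Heps)).
  apply filter_imp. intros h [Hh H]. eapply Rle_trans; [|exact H]. right.
  apply block_norm_ext. intros j. now rewrite Hg. }
split.
- intros Hgen n.
  set (d := fun j => (row D P y n j
    - shift_series (D n) (generator_coef (r n)) (row D P x n) j)%C).
  assert (Hd : N n d <= 0).
  { apply le_epsilon. intros eps Heps. rewrite Rplus_0_l.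
    assert (Heps2 : 0 < eps / 2) by lra.
    assert (Hy := filterlim_row (at_right 0) _ g y n (eps / 2) Heps2 Hgen).
    destruct (filter_ex (F := at_right 0) _
      (filter_and _ _ (Hq n (eps / 2) Heps2) Hy)) as [h [H1 H2]].
    eapply Rle_trans.
    - apply (block_norm_triangle (D n) (P n) (HP n)
        (fun j => - (1) * (row D P (g h) n j - row D P y n j))%C
        (fun j => row D P (g h) n j
          - shift_series (D n) (generator_coef (r n)) (row D P x n) j)%C).
      intros j. unfold d. ring.
    - assert (H3 := block_norm_scal (D n) (P n) (- (1))%C
        (fun j => row D P (g h) n j - row D P y n j)%C _ (fun j => eq_refl)).
      rewrite Cmod_m1 in H3. unfold N in *. lra. }
  intros j. destruct (Nat.le_gt_cases j (D n)) as [Hj|Hj].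
  + assert (Hdj : d j = 0).
    { apply Cmod_eq_0, Rle_antisym; [|apply Cmod_ge_0].
      eapply Rle_trans; [|exact Hd]. now apply block_norm_coord. }
    unfold d in Hdj. rewrite <- (Cplus_0_l (shift_series _ _ _ _)), <- Hdj. ring.
  + rewrite row_supported by easy.
    now rewrite shift_series_supported by (easy || apply row_supported).
- intros Hy. apply (c0_filterlim (at_right 0) _ g y y 2); [lra| |].
  + intros n eps Heps. generalize (Hq n eps Heps). apply filter_imp.
    intros h Hh. eapply Rle_trans; [|exact Hh]. right.
    apply block_norm_ext. intros j. now rewrite Hy.
  + generalize Hpos. apply filter_imp. intros h Hh n.
    assert (HL := block_semigroup_lipschitz (D n) (P n) (r n) (HP n) h
      (row D P x n) (Rlt_le _ _ Hh) (row_supported _ _ _ n)).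
    cbv beta in HL.
    assert (Hh' : 0 < / h) by now apply Rinv_0_lt_compat.
    assert (HA : N n (shift_series (D n) (generator_coef (r n)) (row D P x n))
      = N n (row D P y n)).
    { apply block_norm_ext. intros j. now rewrite Hy. }
    assert (H1 : N n (row D P (g h) n) <= / h * N n (fun j =>
      shift_series (D n) (semigroup_coef (r n) h) (row D P x n) j
      - row D P x n j)%C).
    { rewrite <- (Rabs_pos_eq (/ h)) at 1 by lra. rewrite <- Cmod_R.
      apply block_norm_scal. intros j. now apply Hg. }
    apply (Rmult_le_compat_l (/ h)) in HL; [|lra].
    rewrite <- Rmult_assoc, Rinv_l, Rmult_1_l in HL by lra.
    assert (H2 := block_norm_scal (D n) (P n) (- (1))%C (row D P y n) _
      (fun j => eq_refl)).
    rewrite Cmod_m1 in H2.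
    eapply Rle_trans.
    * apply (block_norm_triangle (D n) (P n) (HP n) (row D P (g h) n)
        (fun j => - (1) * row D P y n j)%C).
      intros j. ring.
    * unfold N in *. lra.
Qed.

Lemma block_sum_C0_semigroup : C0_semigroup block_sum_semigroup.
Proof.
split.
- intros t _. apply c0_series_linear.
- intros f. apply c0_sum_ext. intros n j.
  rewrite block_sum_semigroupE by lra. apply block_semigroup_0.
- intros s t f Hs Ht. apply c0_sum_ext. intros n j.
  rewrite block_sum_semigroupE by lra.
  rewrite (block_sum_semigroupE s) by lra.
  rewrite (block_semigroup_plus (D n)) by apply row_supported.
  apply shift_series_ext; [easy|]. intros k.
  now rewrite block_sum_semigroupE by lra.
- intros f. apply (c0_filterlim (at_right 0) _ (fun t => block_sum_semigroup t f)
    f f 2); [lra| |].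
  + intros n eps Heps.
    set (a := N n (shift_series (D n) (generator_coef (r n)) (row D P f n))).
    assert (Ha : 0 <= a) by apply block_norm_ge0, HP.
    assert (Hd : 0 < eps / (a + 1)) by (apply Rdiv_lt_0_compat; lra).
    exists (mkposreal _ Hd). intros h Hh Hh0.
    change (Rabs (h - 0) < eps / (a + 1)) in Hh.
    rewrite Rminus_0_r, Rabs_pos_eq in Hh by lra.
    unfold N. rewrite (block_norm_ext _ _ _ (fun j =>
      shift_series (D n) (semigroup_coef (r n) h) (row D P f n) j
      - row D P f n j)%C).
    * eapply Rle_trans.
      { apply block_semigroup_lipschitz; [apply HP|lra|apply row_supported]. }
      fold (N n). fold a. apply Rle_trans with (eps / (a + 1) * (a + 1)).
      { apply Rmult_le_compat; lra. }
      right. field. lra.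
    * intros j. now rewrite block_sum_semigroupE by lra.
  + exists (mkposreal 1 Rlt_0_1). intros h _ Hh n.
    assert (HT := block_sum_semigroup_row h f n).
    assert (H2 := block_norm_scal (D n) (P n) (- (1))%C (row D P f n) _
      (fun j => eq_refl)).
    rewrite Cmod_m1 in H2.
    eapply Rle_trans.
    * apply (block_norm_triangle (D n) (P n) (HP n)
        (row D P (block_sum_semigroup h f) n)
        (fun j => - (1) * row D P f n j)%C).
      intros j. ring.
    * unfold N in *. lra.
Qed.

Lemma op_norm_le (L : X -> X) (K : R) :
  (forall f, norm f <= 1 -> norm (L f) <= K) -> Rbar_le (op_norm L) K.
Proof.
intros H. apply Lub_Rbar_correct. intros x [f [Hf ->]]. now apply H.
Qed.

Lemma block_sum_bounded : bounded_semigroup block_sum_semigroup.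
Proof.
exists 1. intros t _. apply op_norm_le. intros f Hf.
apply c0_norm_le. intros n.
eapply Rle_trans; [apply block_sum_semigroup_row|].
eapply Rle_trans; [apply row_norm_le|exact Hf].
Qed.

Section Resolvent.

Variables (s K : R).
Hypothesis HK : 0 < K.
Hypothesis Hres : uniformly_bounded (fun n => resolvent_coef (r n) s) K.

Let Res : X -> X := c0_series _ K HK Hres.

(** Both products of the power series of [i s - A] and of its inverse in the
    shift are the constant series 1. *)
Lemma block_sum_shift (x y : X) :
  op_shift (0, s) (generator block_sum_semigroup) x y <-> x = Res y.
Proof.
set (c := fun n j => ((0%R, s) * delta0 j + - generator_coef (r n) j)%C).
assert (Hc : forall n (f : X) k, shift_series (D n) (c n) (row D P f n) k
  = ((0%R, s) * row D P f n k
     - shift_series (D n) (generator_coef (r n)) (row D P f n) k)%C).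
{ intros n f k. unfold c. rewrite shift_series_plus_l, shift_series_scal_l.
  rewrite shift_series_delta0. unfold Cminus. f_equal.
  rewrite (shift_series_ext _ _ (fun j => (- (1) * generator_coef (r n) j)%C)
    _ (row D P f n)).
  - rewrite shift_series_scal_l. ring.
  - intros j. ring.
  - easy. }
assert (Hinv : forall n (f : X) k,
  shift_series (D n) (conv (c n) (resolvent_coef (r n) s)) (row D P f n) k
  = row D P f n k).
{ intros n f k. rewrite <- (shift_series_delta0 (D n) (row D P f n) k).
  apply shift_series_ext; [|easy]. intros j. apply resolvent_coef_conv. }
split.
- intros [z [Hz ->]]. apply c0_sum_ext. intros n k. rewrite block_sum_generator in Hz.
  rewrite <- Hinv.
  rewrite (shift_series_ext (D n) _ (conv (resolvent_coef (r n) s) (c n)) _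
    (row D P x n)) by (easy || intros j; apply conv_comm).
  rewrite <- shift_series_comp by apply row_supported.
  apply shift_series_ext; [easy|]. intros j. rewrite Hc, <- Hz. simpl. ring_C.
- intros ->.
  exists (minus (scal ((0, s) : C) (Res y)) y). split.
  + apply block_sum_generator. intros n k.
    assert (H : shift_series (D n) (c n) (row D P (Res y) n) k = row D P y n k).
    { rewrite <- Hinv, <- shift_series_comp by apply row_supported. easy. }
    rewrite Hc in H. simpl row at 1.
    transitivity ((0%R, s) * row D P (Res y) n k - row D P y n k)%C.
    * simpl. ring_C.
    * rewrite <- H. ring.
  + apply c0_sum_ext. intros n k. simpl. ring_C.
Qed.

Lemma block_sum_resolvent (y : X) :
  resolvent (0, s) (generator block_sum_semigroup) y = Res y.
Proof.
apply (iota_unique (V := X)).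
- intros x. apply block_sum_shift.
- now apply block_sum_shift.
Qed.

Lemma block_sum_resolvent_set :
  resolvent_set (generator block_sum_semigroup) (0, s).
Proof.
split.
- intros y. exists (Res y). split.
  + now apply block_sum_shift.
  + intros x Hx. symmetry. now apply block_sum_shift.
- destruct (c0_series_linear _ K HK Hres) as [H1 H2 [M [HM H3]]].
  split.
  + intros f g. rewrite !block_sum_resolvent. apply H1.
  + intros a f. rewrite !block_sum_resolvent. apply H2.
  + exists M. split; [easy|]. intros f. rewrite block_sum_resolvent. apply H3.
Qed.

Lemma block_sum_resolvent_norm :
  Rbar_le (op_norm (resolvent (0, s) (generator block_sum_semigroup))) K.
Proof.
apply op_norm_le. intros f Hf. rewrite block_sum_resolvent.
apply c0_norm_le. intros n. eapply Rle_trans; [apply Hres, row_supported|].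
rewrite <- (Rmult_1_r K) at 2. apply Rmult_le_compat_l; [lra|].
eapply Rle_trans; [apply row_norm_le|exact Hf].
Qed.

End Resolvent.

Definition single_block (n : nat) (v : nat -> C) (Hv : supported (D n) v) : X.
Proof.
refine (C0Sum D P (fun m => if Nat.eq_dec m n then v else fun _ => RtoC 0) _ _).
- intros m. now destruct (Nat.eq_dec m n) as [->|].
- intros eps Heps. exists (S n). intros m Hm.
  destruct (Nat.eq_dec m n) as [->|_]; [lia|].
  eapply Rle_trans.
  + apply block_norm_scal with (a := RtoC 0) (v := fun _ => RtoC 0).
    intros j. ring.
  + rewrite Cmod_0. lra.
Defined.

Lemma single_block_norm (n : nat) (v : nat -> C) (Hv : supported (D n) v) :
  norm (single_block n v Hv) <= N n v.
Proof.
apply c0_norm_le. intros m. simpl.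
destruct (Nat.eq_dec m n) as [->|_]; [apply Rle_refl|].
apply Rle_trans with 0; [|apply block_norm_ge0, HP].
eapply Rle_trans.
- apply block_norm_scal with (a := RtoC 0) (v := fun _ => RtoC 0).
  intros j. ring.
- rewrite Cmod_0. lra.
Qed.

(** Evaluating an orbit of [A^-1] at one coordinate of one block bounds the norm
    of [T(t) A^-1] from below. *)
Lemma block_sum_decay_lower_bound (n : nat) (v : nat -> C) (a t K0 : R)
  (HK0 : 0 < K0)
  (Hres : uniformly_bounded (fun n => resolvent_coef (r n) 0) K0) :
  supported (D n) v -> 0 <= r n -> (r n + 2) * N n v <= 1 -> 0 <= t ->
  Rbar_le
    (Rabs a * Cmod (shift_series (D n) (semigroup_coef (r n) t) v 0))
    (op_norm (fun x : X => scal (RtoC a)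
      (block_sum_semigroup t (op_inv (generator block_sum_semigroup) x)))).
Proof.
intros Hv Hr Hnorm Ht.
set (w := shift_series (D n) (generator_coef (r n)) v).
assert (Hw : supported (D n) w) by now apply shift_series_supported.
assert (Hgen : generator block_sum_semigroup (single_block n v Hv)
  (single_block n w Hw)).
{ apply block_sum_generator. intros m j. simpl.
  destruct (Nat.eq_dec m n) as [->|_]; [easy|].
  symmetry. apply (sum_n_zero C_AbelianMonoid). intros i _. apply Cmult_0_r. }
assert (Hinv : op_inv (generator block_sum_semigroup) (single_block n w Hw)
  = single_block n v Hv).
{ apply (iota_unique (V := X)); [|exact Hgen].
  assert (Huniq : forall x, generator block_sum_semigroup x (single_block n w Hw) ->
    x = c0_series _ K0 HK0 Hres (opp (single_block n w Hw))).
  { intros x Hx. apply block_sum_shift. exists (single_block n w Hw).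
    split; [exact Hx|]. apply c0_sum_ext. intros m j. simpl.
    change ((0%R, 0%R) : C) with (RtoC 0). ring_C. }
  intros x Hx. rewrite (Huniq x Hx). symmetry. now apply Huniq. }
apply Rbar_le_trans with
  (norm (scal (RtoC a) (block_sum_semigroup t (single_block n v Hv)))).
- assert (H := coord_le D P HP
    (scal (RtoC a) (block_sum_semigroup t (single_block n v Hv))) n 0).
  change (Rabs a * Cmod (shift_series (D n) (semigroup_coef (r n) t) v 0)
    <= c0_norm D P
      (scal (RtoC a) (block_sum_semigroup t (single_block n v Hv)))).
  eapply Rle_trans; [|exact H]. right. rewrite <- Cmod_R, <- Cmod_mult. f_equal.
  transitivity (RtoC a * row D P (block_sum_semigroup t (single_block n v Hv)) n 0)%C.
  + f_equal. rewrite block_sum_semigroupE by easy. apply shift_series_ext; [easy|].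
    intros j. simpl. now destruct (Nat.eq_dec n n).
  + easy.
- apply Lub_Rbar_correct. exists (single_block n w Hw).
  split; [|now rewrite Hinv].
  eapply Rle_trans; [apply single_block_norm|].
  eapply Rle_trans; [|exact Hnorm]. now apply block_generator_bound.
Qed.

End SumOfBlocks.

(** * A row on which the semigroup decays late *)

Lemma exp_nondecreasing (x y : R) : x <= y -> exp x <= exp y.
Proof.
intros [H| ->]; [left; now apply exp_increasing|apply Rle_refl].
Qed.

Definition test_row (D : nat) (t : R) (j : nat) : C :=
  if le_dec j D then RtoC (near t j) else 0.

Lemma test_row_supported (D : nat) (t : R) : supported D (test_row D t).
Proof. intros j Hj. unfold test_row. destruct (le_dec j D); [lia|easy]. Qed.

Lemma near_bounds (t : R) (j : nat) : 0 <= near t j <= 1.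
Proof. unfold near. destruct (Rle_dec _ _); lra. Qed.

(** On the support of [near t], of length about [4 sqrt t], the weight
    [(1 + 1/P)^j] is at most [exp (3 t / P) <= P^(1/4)]; as [sqrt t <= P^(3/4)],
    the weighted sum is [O(P)]. *)
Lemma test_row_norm (D : nat) (P t : R) :
  1 <= P -> 1 <= t -> 12 * t <= P * ln P ->
  block_norm D P (test_row D t) <= 6.
Proof.
intros HP Ht HtP.
assert (Hcoord : forall j, Cmod (test_row D t j) <= near t j).
{ intros j. assert (H := near_bounds t j). unfold test_row.
  destruct (le_dec j D); [|rewrite Cmod_0; lra].
  rewrite Cmod_R, Rabs_pos_eq; lra. }
assert (HP' : 0 < / P) by (apply Rinv_0_lt_compat; lra).
(* [y = P^(1/4)]. *)
set (y := exp (ln P / 4)).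
assert (Hy1 : 1 <= y).
{ unfold y. rewrite <- exp_0. apply exp_nondecreasing.
  assert (0 <= ln P); [|lra]. rewrite <- ln_1. apply ln_le; lra. }
assert (Hy4 : y ^ 4 = P).
{ rewrite <- (exp_ln P) by lra. unfold y. simpl. rewrite Rmult_1_r, <- !exp_plus.
  f_equal. field. }
assert (Hlny : ln P = 4 * ln y) by (unfold y; rewrite ln_exp; field).
assert (Hln : ln y <= y).
{ rewrite <- (ln_exp y) at 2. apply ln_le; [lra|].
  assert (H := exp_ineq1_le y). lra. }
assert (Hst : sqrt t <= y ^ 3).
{ rewrite <- (sqrt_pow2 (y ^ 3)) by (apply pow_le; lra). apply sqrt_le_1_alt.
  replace ((y ^ 3) ^ 2) with (y ^ 4 * y ^ 2) by ring. rewrite Hy4.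
  assert (P * ln P <= 4 * (P * y)).
  { rewrite Hlny. replace (P * (4 * ln y)) with (4 * (P * ln y)) by ring.
    apply Rmult_le_compat_l; [lra|]. apply Rmult_le_compat_l; lra. }
  assert (P * y <= P * y ^ 2) by (apply Rmult_le_compat_l; nra). lra. }
assert (Hs1 : 1 <= sqrt t) by (rewrite <- sqrt_1; now apply sqrt_le_1_alt).
assert (Hstt : sqrt t <= t).
{ rewrite <- (sqrt_sqrt t) at 2 by lra. nra. }
assert (Hsum : weighted_sum D P (test_row D t) <= 5 * P).
{ apply Rle_trans with (sum_n (fun j => y * near t j) D).
  - apply sum_n_le. intros j _.
    apply Rle_trans with ((1 + / P) ^ j * near t j).
    { apply Rmult_le_compat_l; [|apply Hcoord]. left. apply weight_gt0. lra. }
    unfold near. destruct (Rle_dec _ _) as [Hj|_]; [|lra].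
    rewrite !Rmult_1_r. apply Rabs_le_between in Hj.
    apply Rle_trans with (exp (/ P) ^ j).
    { apply pow_incr. split; [lra|]. apply exp_ineq1_le. }
    rewrite <- Rpower_pow by apply exp_pos. unfold Rpower, y. rewrite ln_exp.
    apply exp_nondecreasing. apply Rle_trans with (3 * t * / P).
    + apply Rmult_le_compat_r; lra.
    + apply (Rmult_le_compat_r (/ P)) in HtP; [|lra].
      replace (P * ln P * / P) with (ln P) in HtP by (field; lra). lra.
  - rewrite sum_n_Rmult_l. assert (H := near_count t D ltac:(lra)).
    apply Rle_trans with (y * (5 * y ^ 3)).
    + apply Rmult_le_compat_l; lra.
    + right. rewrite <- Hy4. ring. }
unfold block_norm.
assert (max_abs D (test_row D t) <= 1).
{ apply max_abs_le. intros j _. assert (H := near_bounds t j).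
  specialize (Hcoord j). lra. }
apply (Rmult_le_compat_l (/ P)) in Hsum; [|lra].
replace (/ P * (5 * P)) with 5 in Hsum by (field; lra). lra.
Qed.

Lemma test_row_orbit (D : nat) (r t : R) :
  0 < t -> t <= INR D -> 3 / 4 <= sum_n (poisson t) D ->
  / 2 <= Cmod (shift_series D (semigroup_coef r t) (test_row D t) 0).
Proof.
intros Ht HD Hsum.
assert (H := poisson_concentration t D Ht HD).
replace (shift_series D (semigroup_coef r t) (test_row D t) 0)
  with (cis (r * t) * RtoC (sum_n (fun j => poisson t j * near t j)%R D))%C.
- rewrite Cmod_mult, Cmod_cis, Rmult_1_l, Cmod_R.
  eapply Rle_trans; [|apply Rle_abs]. lra.
- rewrite RtoC_sum_n, <- sum_n_Cmult_l. apply sum_n_ext_loc. intros j Hj.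
  unfold semigroup_coef, test_row. simpl. destruct (le_dec j D); [|easy].
  rewrite RtoC_mult. ring_C.
Qed.

(** The truncation at [D] has to keep most of the Poisson mass. *)
Lemma poisson_cutoff_exists (t : R) :
  exists D : nat, t <= INR D /\ 3 / 4 <= sum_n (poisson t) D.
Proof.
assert (Hs := poisson_sum t).
assert (H : eventually (fun n => t <= INR n /\ 3 / 4 <= sum_n (poisson t) n)).
{ apply filter_and.
  - destruct (nfloor_ex (Rmax 0 t) (Rmax_l _ _)) as [m Hm]. exists (S m).
    intros n Hn. apply le_INR in Hn. rewrite S_INR in Hn.
    assert (H0 := Rmax_r 0 t). lra.
  - assert (Hq : 0 < / 4) by lra.
    generalize (proj1 (filterlim_locally _ _) Hs (mkposreal _ Hq)).
    apply filter_imp. intros n Hn.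
    change (Rabs (sum_n (poisson t) n - 1) < / 4) in Hn.
    apply Rabs_lt_between in Hn. lra. }
destruct H as [n Hn]. exists n. now apply Hn.
Qed.

(** * Choice of the frequencies *)

(** A function of at most exponential growth cannot gain the factor
    [exp (2 alpha)] on every unit interval. *)
Lemma slow_growth_points (M : R -> R) (C alpha s0 : R) :
  (forall s, 0 <= s -> 0 < M s) -> 0 < C -> 0 < alpha ->
  (forall s, s0 <= s -> M s <= C * exp (alpha * s)) ->
  exists s, s0 <= s /\ 1 <= s /\ M s <= exp (2 * alpha) * M (s - 1).
Proof.
intros Mpos HC Ha HM.
apply NNPP. intros Hno.
set (b := Rmax s0 1).
assert (Hb0 : s0 <= b) by apply Rmax_l. assert (Hb1 : 1 <= b) by apply Rmax_r.
assert (Hgrow : forall k, exp (alpha * INR k) * exp (alpha * INR k) * M b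
  <= M (b + INR k)).
{ induction k as [|k IH].
  - simpl. rewrite Rmult_0_r, exp_0, Rplus_0_r. lra.
  - assert (Hk := pos_INR k). apply Rnot_lt_le. intros Hlt. apply Hno.
    exists (b + INR (S k)). rewrite S_INR in *. repeat split; try lra.
    replace (b + (INR k + 1) - 1) with (b + INR k) by ring.
    left. eapply Rlt_le_trans; [exact Hlt|].
    replace (exp (alpha * (INR k + 1)) * exp (alpha * (INR k + 1)) * M b)
      with (exp (2 * alpha)
            * (exp (alpha * INR k) * exp (alpha * INR k) * M b)).
    + apply Rmult_le_compat_l; [left; apply exp_pos|exact IH].
    + rewrite <- Rmult_assoc. f_equal. rewrite <- !exp_plus. f_equal. ring. }
assert (HMb : 0 < M b) by (apply Mpos; lra).
assert (Hcap : forall k, exp (alpha * INR k) * M b <= C * exp (alpha * b)).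
{ intros k. apply Rmult_le_reg_l with (exp (alpha * INR k)); [apply exp_pos|].
  rewrite <- Rmult_assoc. eapply Rle_trans; [apply Hgrow|].
  eapply Rle_trans; [apply HM; assert (H := pos_INR k); lra|].
  right. rewrite Rmult_plus_distr_l, exp_plus. ring. }
set (E := C * exp (alpha * b)) in *.
assert (HE : 0 < E) by (apply Rmult_lt_0_compat; [easy|apply exp_pos]).
destruct (nfloor_ex (E / (M b * alpha))) as [k Hk].
{ apply Rdiv_le_0_compat; [lra|]. now apply Rmult_lt_0_compat. }
assert (HMa : 0 < M b * alpha) by now apply Rmult_lt_0_compat.
specialize (Hcap (S k)). rewrite S_INR in Hcap.
assert (H1 := exp_ineq1_le (alpha * (INR k + 1))).
assert (H2 : E < (INR k + 1) * (M b * alpha)) by (apply Rlt_div_l; lra).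
nra.
Qed.

(** At a point of slow growth beyond a suitable bound, the time [M_log M s / c] is
    short enough for a block with [P = 24 M s]: with [c = 1 + 1/beta] the lower
    bound on [M] gives [M_log M s <= 2 c (M s) (ln (M s))], and [24 = 12 * 2]. *)
Lemma frequencies_exist (M : R -> R) (beta : R) :
  regularly_growing M -> 0 < beta -> growth_bounds M beta ->
  exists C1, 0 < C1 /\ forall n : nat, exists s,
    1 <= s /\ M s <= C1 * M (s - 1) /\ 1 <= M s /\
    INR n + 1 <= M_log M s / (1 + / beta) /\
    12 * (M_log M s / (1 + / beta)) <= 24 * M s * ln (24 * M s).
Proof.
intros [Mpos Mmono _ _ _] Hbeta [C [alpha [HC [Ha [s1 Hs1]]]]].
exists (exp (2 * alpha)). split; [apply exp_pos|]. intros n.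
set (c := 1 + / beta).
assert (Hb' : 0 < / beta) by now apply Rinv_0_lt_compat.
assert (Hc : 1 < c) by (unfold c; lra).
(* Beyond [exp (B / beta)], [ln (M s)] exceeds [B - ln C]; the constant [B]
   makes [ln (M s)] absorb the additive constants in [M_log]. *)
set (B := Rabs (ln C) + 2 * ln 2 + Rabs (ln C) * / beta).
assert (Hln2 : 0 < ln 2) by (rewrite <- ln_1; apply ln_increasing; lra).
destruct (slow_growth_points M C alpha
  (Rmax (s1 + 1) (Rmax (exp (B * / beta)) (exp (c * (INR n + 1))))))
  as [s [Hs [Hs' HMs]]]; [easy|easy|easy| |].
{ intros s Hs. apply Hs1. assert (H := Rmax_l (s1 + 1)
    (Rmax (exp (B * / beta)) (exp (c * (INR n + 1))))). lra. }
exists s.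
assert (Hsa : s1 + 1 <= s) by (eapply Rle_trans; [apply Rmax_l|exact Hs]).
assert (Hsb : exp (B * / beta) <= s).
{ eapply Rle_trans; [|exact Hs]. eapply Rle_trans; [apply Rmax_l|apply Rmax_r]. }
assert (Hsc : exp (c * (INR n + 1)) <= s).
{ eapply Rle_trans; [|exact Hs]. eapply Rle_trans; [apply Rmax_r|apply Rmax_r]. }
destruct (Hs1 s ltac:(lra)) as [Hlow _].
assert (HMpos : 0 < M s) by (apply Mpos; lra).
assert (HlnM : beta * ln s - ln C <= ln (M s)).
{ rewrite <- (ln_exp (beta * ln s)). fold (Rpower s beta).
  replace (ln (Rpower s beta) - ln C) with (ln (/ C * Rpower s beta)).
  - apply ln_le; [|easy]. apply Rmult_lt_0_compat; [|apply exp_pos].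
    now apply Rinv_0_lt_compat.
  - rewrite ln_mult, ln_Rinv; [ring|easy| |apply exp_pos].
    now apply Rinv_0_lt_compat. }
assert (Hlns : B * / beta <= ln s).
{ rewrite <- (ln_exp (B * / beta)). apply ln_le; [apply exp_pos|easy]. }
assert (HB : B <= beta * ln s).
{ apply (Rmult_le_compat_l beta) in Hlns; [|lra].
  replace (beta * (B * / beta)) with B in Hlns by (field; lra). easy. }
assert (HC1 : ln C <= Rabs (ln C)) by apply Rle_abs.
assert (HC0 := Rabs_pos (ln C)).
assert (HCb : 0 <= Rabs (ln C) * / beta) by (apply Rmult_le_pos; lra).
assert (HM1 : 2 * ln 2 + Rabs (ln C) * / beta <= ln (M s)) by (unfold B in HB; lra).
assert (HMge1 : 1 <= M s).
{ rewrite <- exp_0, <- (exp_ln (M s)) by easy. apply exp_nondecreasing. lra. }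
assert (Hln1s : ln (1 + s) <= ln 2 + ln s).
{ rewrite <- ln_mult by lra. apply ln_le; lra. }
assert (Hln1M : ln (1 + M s) <= ln 2 + ln (M s)).
{ rewrite <- ln_mult by lra. apply ln_le; lra. }
assert (Hln1M0 : 0 <= ln (1 + M s)) by (rewrite <- ln_1; apply ln_le; lra).
assert (Hlns' : ln s <= / beta * ln (M s) + Rabs (ln C) * / beta).
{ apply (Rmult_le_compat_l (/ beta)) in HlnM; [|lra].
  replace (/ beta * (beta * ln s - ln C)) with (ln s - / beta * ln C) in HlnM
    by (field; lra).
  apply (Rmult_le_compat_l (/ beta)) in HC1; lra. }
assert (Hlog : M_log M s <= M s * (2 * c * ln (M s))).
{ apply Rmult_le_compat_l; [lra|]. unfold c. nra. }
repeat split; try easy.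
- apply Rle_div_r; [lra|].
  apply Rle_trans with (1 * (ln (1 + s) + ln (1 + M s))).
  + assert (c * (INR n + 1) <= ln (1 + s)); [|lra].
    rewrite <- (ln_exp (c * (INR n + 1))). apply ln_le; [apply exp_pos|lra].
  + apply Rmult_le_compat_r; [|easy].
    assert (0 <= ln (1 + s)); [|lra]. rewrite <- ln_1. apply ln_le; lra.
- apply Rle_trans with (24 * M s * ln (M s)).
  + replace (24 * M s * ln (M s)) with (12 * (M s * (2 * c * ln (M s)) / c))
      by (field; lra).
    apply Rmult_le_compat_l; [lra|]. apply Rmult_le_compat_r; [|easy].
    left. apply Rinv_0_lt_compat. lra.
  + apply Rmult_le_compat_l; [lra|]. apply ln_le; lra.
Qed.

Lemma M_log_inv_M_log (M : R -> R) (s : R) :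
  regularly_growing M -> 0 <= s -> M_log_inv M (M_log M s) = s.
Proof.
intros [Mpos Mmono _ _ _] Hs.
assert (Hstrict : forall x y, 0 <= x -> x < y -> M_log M x < M_log M y).
{ intros x y Hx Hxy. unfold M_log.
  assert (HMx := Mpos x Hx). assert (HMxy := Mmono x y Hx (Rlt_le _ _ Hxy)).
  assert (H1 : ln (1 + x) < ln (1 + y)) by (apply ln_increasing; lra).
  assert (H2 : ln (1 + M x) <= ln (1 + M y)) by (apply ln_le; lra).
  assert (H3 : 0 <= ln (1 + x)) by (rewrite <- ln_1; apply ln_le; lra).
  assert (H4 : 0 <= ln (1 + M x)) by (rewrite <- ln_1; apply ln_le; lra).
  apply Rlt_le_trans with (M x * (ln (1 + y) + ln (1 + M y))).
  - apply Rmult_lt_compat_l; lra.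
  - apply Rmult_le_compat_r; lra. }
apply (iota_unique (V := R_CompleteNormedModule)); [|easy].
intros x [Hx Hxs]. destruct (Rtotal_order x s) as [H|[H|H]]; [|easy|].
- specialize (Hstrict x s Hx H). lra.
- specialize (Hstrict s x Hs H). lra.
Qed.

Lemma limsup_p_infty_ge (f : R -> Rbar) (l : Rbar) :
  (forall t0, exists t, t0 <= t /\ Rbar_le l (f t)) ->
  Rbar_le l (limsup_p_infty f).
Proof.
intros H. unfold limsup_p_infty, Rbar_glb.
destruct (Rbar_ex_glb _) as [g [Hg0 Hg]]. apply Hg. intros u [t0 ->].
destruct (H t0) as [t [Ht Hl]]. eapply Rbar_le_trans; [exact Hl|].
unfold Rbar_lub. destruct (Rbar_ex_lub _) as [b [Hb Hb0]]. apply Hb. now exists t.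
Qed.

Theorem theorem3p1 (M : R -> R) (beta : R)
  (hM : regularly_growing M)
  (hbeta : 0 < beta)
  (hMbeta : growth_bounds M beta) :
  exists (X : CompleteNormedModule C_AbsRing) (T : R -> X -> X),
    C0_semigroup T /\
    bounded_semigroup T /\
    (forall s : R, ~ spectrum (generator T) (0, s)) /\
    (exists K s0 : R, forall s : R, s0 <= Rabs s ->
      Rbar_le (op_norm (resolvent (0, s) (generator T)))
        (Finite (K * M (Rabs s)))) /\
    Rbar_lt (Finite 0)
      (limsup_p_infty (fun t =>
        op_norm (fun x : X =>
          scal (RtoC (M_log_inv M ((1 + / beta) * t)))
            (T t (op_inv (generator T) x))))).
Proof.
destruct (frequencies_exist M beta hM hbeta hMbeta) as [C1 [HC1 Hfreq]].
set (c := 1 + / beta) in *.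
assert (Hc : 1 < c).
{ assert (0 < / beta) by now apply Rinv_0_lt_compat. unfold c. lra. }
destruct (functional_choice (fun (n : nat) s =>
  1 <= s /\ M s <= C1 * M (s - 1) /\ 1 <= M s /\
  INR n + 1 <= M_log M s / c /\
  12 * (M_log M s / c) <= 24 * M s * ln (24 * M s)) Hfreq) as [r Hr].
set (t := fun n => M_log M (r n) / c) in *.
destruct (functional_choice
  (fun n D => t n <= INR D /\ 3 / 4 <= sum_n (poisson (t n)) D)
  (fun n => poisson_cutoff_exists (t n))) as [D HD].
set (P := fun n => 24 * M (r n)).
assert (HP1 : forall n, 1 <= P n).
{ intros n. destruct (Hr n) as [_ [_ [H _]]]. unfold P. lra. }
assert (HP : forall n, 0 < P n) by (intros n; specialize (HP1 n); lra).
assert (Mpos := rg_pos M hM). assert (Mmono := rg_nondecreasing M hM).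
(* Near [r n] the resolvent bound is [2 P + 1 <= 49 M (r n)]; far from [r n] it is
   [3], and [M 0 <= M (Rabs s)]. *)
set (K := 49 * C1 + 3 / M 0).
assert (HM0 : 0 < M 0) by (apply Mpos; lra).
assert (HK3 : 0 < 3 / M 0) by (apply Rdiv_lt_0_compat; lra).
assert (HKs : forall s, 0 < K * M (Rabs s)).
{ intros s. apply Rmult_lt_0_compat; [unfold K; lra|]. apply Mpos, Rabs_pos. }
assert (Hres : forall s,
  uniformly_bounded D P (fun n => resolvent_coef (r n) s) (K * M (Rabs s))).
{ intros s n v Hv. destruct (Hr n) as [Hr1 [HrM [HM1 _]]].
  assert (HN := block_norm_ge0 (D n) (P n) (HP n) v).
  assert (Hs0 := Rabs_pos s). assert (HMs := Mpos _ Hs0).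
  destruct (Rle_lt_dec 1 (Rabs (s - r n))) as [Hfar|Hnear].
  - eapply Rle_trans; [now apply block_resolvent_bound_far|].
    apply Rmult_le_compat_r; [easy|].
    apply Rle_trans with (3 / M 0 * M (Rabs s)).
    + apply Rle_trans with (3 / M 0 * M 0); [right; field; lra|].
      apply Rmult_le_compat_l; [lra|]. apply Mmono; lra.
    + apply Rmult_le_compat_r; [lra|]. unfold K. lra.
  - eapply Rle_trans; [now apply block_resolvent_bound|].
    apply Rmult_le_compat_r; [easy|].
    assert (Hle : M (r n - 1) <= M (Rabs s)).
    { apply Mmono; [lra|]. apply Rabs_lt_between in Hnear.
      assert (H := Rle_abs s). lra. }
    apply (Rmult_le_compat_l C1) in Hle; [|lra].
    apply Rle_trans with (49 * C1 * M (Rabs s)).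
    + unfold P. lra.
    + apply Rmult_le_compat_r; [lra|]. unfold K. lra. }
exists (c0_space D P HP), (block_sum_semigroup D P r HP).
split; [apply block_sum_C0_semigroup|].
split; [apply block_sum_bounded|].
split.
{ intros s H. apply H. exact (block_sum_resolvent_set D P r HP s _ (HKs s) (Hres s)). }
split.
{ exists K, 0. intros s _.
  exact (block_sum_resolvent_norm D P r HP s _ (HKs s) (Hres s)). }
apply Rbar_lt_le_trans with (/ 36); [simpl; lra|].
apply limsup_p_infty_ge. intros t0.
destruct (nfloor_ex (Rmax 0 t0) (Rmax_l _ _)) as [n Hn].
destruct (Hr n) as [Hr1 [_ [_ [Htn HtP]]]]. fold (t n) in Htn, HtP.
destruct (HD n) as [HD1 HD2].
exists (t n). assert (Ht0 := Rmax_r 0 t0). assert (Hn0 := pos_INR n).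
split; [lra|].
replace (c * t n) with (M_log M (r n)) by (unfold t; field; lra).
rewrite M_log_inv_M_log by (easy || lra).
(* The norm of the test row is at most 6, and that of the generator on the block
   at most [r n + 2]. *)
set (k := / (6 * (r n + 2))).
assert (Hk : 0 < k) by (apply Rinv_0_lt_compat; lra).
assert (Hsupp : supported (D n) (fun j => RtoC k * test_row (D n) (t n) j)%C).
{ intros j Hj. rewrite test_row_supported by easy. ring. }
eapply Rbar_le_trans; [|apply (block_sum_decay_lower_bound D P r HP n _ (r n) (t n)
  _ (HKs 0) (Hres 0) Hsupp); [lra| |lra]].
- rewrite shift_series_scal_r, Cmod_mult, Cmod_R, !Rabs_pos_eq by lra.
  assert (Horb := test_row_orbit (D n) (r n) (t n) ltac:(lra) HD1 HD2).
  simpl. apply Rle_trans with (r n * (k * / 2)).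
  + unfold k. replace (r n * (/ (6 * (r n + 2)) * / 2))
      with (r n / (12 * (r n + 2))) by (field; lra).
    apply Rle_div_r; lra.
  + apply Rmult_le_compat_l; [lra|]. apply Rmult_le_compat_l; lra.
- assert (H := test_row_norm (D n) (P n) (t n) (HP1 n) ltac:(lra) HtP).
  apply Rle_trans with ((r n + 2) * (k * 6)).
  + apply Rmult_le_compat_l; [lra|].
    eapply Rle_trans; [now apply block_norm_scal with (a := RtoC k)|].
    rewrite Cmod_R, Rabs_pos_eq by lra. apply Rmult_le_compat_l; lra.
  + right. unfold k. field. lra.
Qed.
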